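(* Let $\phi\in\mathbb{Q}(x)$ be a rational function of degree $2$ having a $2$-periodic critical point, and suppose that $\operatorname{Aut}(\phi)$ is nontrivial. Then there exists $v\in\mathbb{Q}\setminus\{0,4\}$ such that $\phi$ is linearly conjugate over $\mathbb{Q}$ to \[\psi_v:=\frac{2x-1}{vx^2-1}.\] Moreover, for any such $v$ with $v\neq 1$: (a) if $v\notin\operatorname{Im}\alpha\cup\operatorname{Im}\beta$, then $G_{3,\phi}\cong W$; (b) if $v\in\operatorname{Im}\alpha$, then $G_{3,\phi}\cong A$, $K$, or $M$; (c) if $v\in\operatorname{Im}\beta$, then $G_{3,\phi}\cong B$ or $M$; (d) if $v\in\operatorname{Im}\mu$, then $G_{3,\phi}\cong M$; (e) if $v\in\operatorname{Im}\kappa$, then $G_{3,\phi}\cong K$.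
   Context: The degree of a rational function $p/q$ ($p,q$ coprime) is $\max\{\deg p,\deg q\}$. A point $P\in\mathbb{P}^1(\overline{\mathbb{Q}})$ is $n$-periodic for $\phi$ if $\phi^n(P)=P$ with $n$ minimal. A critical point is a ramification point of $\phi:\mathbb{P}^1\to\mathbb{P}^1$. Two maps $\phi,\psi$ are linearly conjugate over $\mathbb{Q}$ if $\psi=\sigma^{-1}\circ\phi\circ\sigma$ for some degree-one $\sigma\in\mathbb{Q}(x)$. $\operatorname{Aut}(\phi)$ is the group of degree-one $\sigma\in\overline{\mathbb{Q}}(x)$ with $\sigma^{-1}\circ\phi\circ\sigma=\phi$. $G_{3,\phi}=\operatorname{Gal}(\mathbb{Q}_{3,\phi}/\mathbb{Q})$ where $\mathbb{Q}_{3,\phi}$ is the compositum of the fields of definition of all $3$-periodic points of $\phi$ in $\mathbb{P}^1(\overline{\mathbb{Q}})$. For $\rho\in\mathbb{Q}(t)$, $\operatorname{Im}\rho$ denotes the set of values $\rho(u)$ for $u\in\mathbb{Q}$ at which $\rho$ is defined. Set $\alpha(t)=\frac{(1+t)^2}{1-t+t^2}$, $\beta(t)=t^2(3-t)$, $\kappa(t)=\frac{(t^3-3t^2-6t-1)^2}{(1+t+t^2)^3}$, $\mu(t)=\alpha\!\left(\frac{t^3-3t-1}{t^3+3t^2-1}\right)$. Groups: $W$ is the centralizer of $(1,2,3)(4,5,6)$ in $S_6$ (so $W\cong(\mathbb{Z}/3\mathbb{Z})\wr S_2$). Up to conjugacy in $W$, the maximal subgroups of $W$ are $A$ (order $9$),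 $B$ (cyclic of order $6$) and $C$ (non-cyclic of order $6$). Up to conjugacy in $W$, the maximal subgroups of $A$ are $J,K,M$, where $J$ is the one contained in a conjugate of $C$, $M$ is the one contained in a conjugate of $B$, and $K$ is the remaining one. *)

(* Defs.v *)
From mathcomp Require Import all_boot all_order all_algebra all_fingroup all_solvable all_field.
Set Implicit Arguments. Unset Strict Implicit. Unset Printing Implicit Defensive.
Import GRing.Theory Num.Theory.
Local Open Scope ring_scope.

(* A rational function over a field F is represented by a pair (p, q) of
   polynomials, meaning p/q; it is a genuine element of F(x) written in lowest
   terms when [rf_valid] holds (q <> 0, p and q coprime).
   P^1(F) is [option F], with [None] the point at infinity. *)
Section RatFun.
Variable F : fieldType.

Definition rf_valid (f : {poly F} * {poly F}) : bool :=
  (f.2 != 0) && coprimep f.1 f.2.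

Definition rf_deg (f : {poly F} * {poly F}) : nat :=
  maxn (size f.1).-1 (size f.2).-1.

Definition rf_eval (f : {poly F} * {poly F}) (P : option F) : option F :=
  match P with
  | Some x => if f.2.[x] == 0 then None else Some (f.1.[x] / f.2.[x])
  | None => if (size f.2 < size f.1)%N then None
            else if size f.1 == size f.2
                 then Some (lead_coef f.1 / lead_coef f.2) else Some 0
  end.

(* Ramification: the ramification index of f at P is the multiplicity of P in
   the fibre f^{-1}(f(P)), i.e. in the divisor of the degree-(rf_deg f) form
   b*p - a*q where f(P) = [a:b].  Dehomogenised: for finite P = x it is the
   order at x of  p - c q  (if f(x) = c is finite) or of q (if f(x) = oo); for
   P = oo it is  rf_deg f - deg(that polynomial).  P is critical iff the index
   is >= 2. *)
Definition rf_fibre (f : {poly F} * {poly F}) (P : option F) : {poly F} :=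
  match rf_eval f P with
  | Some c => f.1 - c%:P * f.2
  | None => f.2
  end.

Definition rf_crit (f : {poly F} * {poly F}) (P : option F) : Prop :=
  match P with
  | Some x => (('X - x%:P) ^+ 2 %| rf_fibre f P)%R
  | None => (size (rf_fibre f P) < rf_deg f)%N
  end.

End RatFun.

Definition periodic (T : Type) (g : T -> T) (n : nat) (P : T) : Prop :=
  (0 < n)%N /\ iter n g P = P /\ (forall m, (0 < m < n)%N -> iter m g P <> P).

Definition rf_map (f : {poly rat} * {poly rat}) : {poly algC} * {poly algC} :=
  (map_poly ratr f.1, map_poly ratr f.2).

Definition dyn (phi : {poly rat} * {poly rat}) : option algC -> option algC :=
  rf_eval (rf_map phi).

(* psi and phi linearly conjugate over Q:  psi = sigma^-1 o phi o sigma for a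
   degree-one sigma in Q(x), i.e.  sigma o psi = phi o sigma. *)
Definition lin_conj_Q (phi psi : {poly rat} * {poly rat}) : Prop :=
  exists sigma : {poly rat} * {poly rat},
    rf_valid sigma /\ rf_deg sigma = 1%N /\
    forall P, dyn sigma (dyn psi P) = dyn phi (dyn sigma P).

(* Aut(phi) nontrivial: some degree-one sigma in Qbar(x), sigma <> x, with
   sigma^-1 o phi o sigma = phi. *)
Definition aut_nontrivial (phi : {poly rat} * {poly rat}) : Prop :=
  exists sigma : {poly algC} * {poly algC},
    rf_valid sigma /\ rf_deg sigma = 1%N /\
    (forall P, rf_eval sigma (dyn phi P) = dyn phi (rf_eval sigma P)) /\
    exists P, rf_eval sigma P <> P.

Definition psi (v : rat) : {poly rat} * {poly rat} :=
  ('X *+ 2 - 1, v *: 'X ^+ 2 - 1).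

Definition is_subfield (K : algC -> Prop) : Prop :=
  K 1 /\ (forall x y, K x -> K y -> K (x - y)) /\
  (forall x y, K x -> K y -> K (x * y)) /\ (forall x, K x -> K x^-1).

Definition gen_field (S : algC -> Prop) : algC -> Prop :=
  fun x => forall K, is_subfield K -> (forall s, S s -> K s) -> K x.

(* compositum of the fields of definition of the 3-periodic points: the field
   of definition of [Some x] is Q(x), that of [None] (infinity) is Q. *)
Definition Q3 (phi : {poly rat} * {poly rat}) : algC -> Prop :=
  gen_field (fun x => periodic (dyn phi) 3 (Some x)).

(* field automorphisms of K (they automatically fix Q) *)
Definition field_aut (K : algC -> Prop) (f : algC -> algC) : Prop :=
  (forall x, K x -> K (f x)) /\ (forall y, K y -> exists2 x, K x & f x = y) /\
  (forall x y, K x -> K y -> f (x + y) = f x + f y) /\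
  (forall x y, K x -> K y -> f (x * y) = f x * f y) /\ f 1 = 1.

Definition c6fun (i : 'I_6) : 'I_6 :=
  Ordinal (ltn_pmod (if (i < 3)%N then (i.+1 %% 3)%N else (3 + (i - 2) %% 3)%N)
             (isT : (0 < 6)%N)).

Lemma c6fun_inj : injective c6fun.
Proof.
apply: (@can_inj _ _ _ (fun i => c6fun (c6fun i))) => i; apply/val_inj.
by case: i => [[|[|[|[|[|[|?]]]]]] Hi].
Qed.

(* (1,2,3)(4,5,6), with points labelled 0..5 *)
Definition cyc6 : 'S_6 := perm c6fun_inj.

Definition W : {group 'S_6} := ('C[cyc6])%G.

(* conjugacy classes in W, described as in the paper *)
Definition isW (H : {group 'S_6}) : Prop := H :=: W.
Definition isA (H : {group 'S_6}) : Prop := maximal H W /\ #|H| = 9%N.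
Definition isB (H : {group 'S_6}) : Prop := [/\ maximal H W, cyclic H & #|H| = 6%N].
Definition isC (H : {group 'S_6}) : Prop := [/\ maximal H W, ~~ cyclic H & #|H| = 6%N].
Definition maxA (H : {group 'S_6}) : Prop :=
  exists A : {group 'S_6}, isA A /\ maximal H A.
Definition isJ (H : {group 'S_6}) : Prop :=
  maxA H /\ exists C : {group 'S_6}, isC C /\ H \subset C.
Definition isM (H : {group 'S_6}) : Prop :=
  maxA H /\ exists B : {group 'S_6}, isB B /\ H \subset B.
Definition isK (H : {group 'S_6}) : Prop :=
  [/\ maxA H, ~ (exists B : {group 'S_6}, isB B /\ H \subset B)
            & ~ (exists C : {group 'S_6}, isC C /\ H \subset C)].

Definition labels3 (phi : {poly rat} * {poly rat}) (l : 'I_6 -> option algC) : Prop :=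
  [/\ injective l, (forall P, periodic (dyn phi) 3 P <-> exists i, l i = P)
    & forall i, dyn phi (l i) = l (cyc6 i)].

(* G_{3,phi} ~= X : under a labelling as above, the action of
   G_{3,phi} = Gal(Q_{3,phi}/Q) on the 3-periodic points identifies it with a
   subgroup H of W in the class X, i.e. the map sending an automorphism to the
   permutation it induces is a bijection onto H. *)
Definition G3_is (phi : {poly rat} * {poly rat}) (X : {group 'S_6} -> Prop) : Prop :=
  exists l, labels3 phi l /\
  exists H : {group 'S_6}, X H /\
    (forall f, field_aut (Q3 phi) f ->
       exists2 s, s \in H & forall i, omap f (l i) = l (s i)) /\
    (forall s, s \in H ->
       exists2 f, field_aut (Q3 phi) f & forall i, omap f (l i) = l (s i)).

Definition alpha (u : rat) : rat := (1 + u) ^+ 2 / (1 - u + u ^+ 2).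
Definition r_mu (u : rat) : rat := (u ^+ 3 - 3 * u - 1) / (u ^+ 3 + 3 * u ^+ 2 - 1).

Definition ImAlpha (v : rat) : Prop :=
  exists u : rat, 1 - u + u ^+ 2 != 0 /\ v = alpha u.
Definition ImBeta (v : rat) : Prop :=
  exists u : rat, v = u ^+ 2 * (3 - u).
Definition ImKappa (v : rat) : Prop :=
  exists u : rat, 1 + u + u ^+ 2 != 0 /\
    v = (u ^+ 3 - 3 * u ^+ 2 - 6 * u - 1) ^+ 2 / (1 + u + u ^+ 2) ^+ 3.
Definition ImMu (v : rat) : Prop :=
  exists u : rat, u ^+ 3 + 3 * u ^+ 2 - 1 != 0 /\
    1 - r_mu u + r_mu u ^+ 2 != 0 /\ v = alpha (r_mu u).

(* Main.v *)
Require Import Defs.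
From mathcomp Require Import all_boot all_order all_algebra all_fingroup all_solvable all_field.
From mathcomp Require Import ring.
From HB Require Import structures.
From Stdlib Require Import ClassicalEpsilon.
Set Implicit Arguments. Unset Strict Implicit. Unset Printing Implicit Defensive.
Import GRing.Theory Num.Theory.
Local Open Scope ring_scope.

(* A degree 2 map with a 2-periodic critical point [P] and a nontrivial automorphism has both
   critical points in that 2-cycle.  In homogeneous coordinates this says that the map is
   divergence free, i.e. of the form [(F_Y : - F_X)] for a binary cubic [F]; such a map is
   determined by its values on a basis, and a basis [P, phi P] of a generic rational point brings
   it to the form [psi v].

   The fixed points of [psi v] are the inverses of the roots [y1, y2, y3] of [y^3 - 3 y^2 + v].
   Sending them to [0, 1, oo] turns [psi v] into [(x^2 - 2 x) / (1 - 2 x)], whose 3-periodic points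
   are the roots [th] of [x^3 - 3 x + 1] and their inverses.  Hence Galois acts on the 3-periodic
   points through its actions on the [y_i] (by a subgroup of [S_3]) and on the [th] (by the full
   cyclic group of order 3), and [W] is the product of these two groups.  The cases of the theorem
   say whether the discriminant of the [y_i] is a square, whether some or all [y_i] are rational,
   and whether the two actions are linked. *)

(** The two critical points may be conjugate over Q, so they cannot be moved to 0 and oo by a
    rational change of coordinates. Vanishing of the divergence is a linear condition on the
    coefficients instead: it is proved over the algebraic closure, where the critical point lives,
    and descends to Q, where a rational starting point can then be chosen freely. On the Galois side
    an automorphism is recorded by exponents [a], [b], [e], with [a] for the action on [th] and
    [(b, e)] for the action on the [y_i]. An automorphism with [a = 1] always exists; besides it,
    each case needs only a constraint on [(b, e)] shared by all automorphisms or, for [W], two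
    further automorphisms that generate [S_3] on the [y_i]. The values 0 and 4 of [v] are those for
    which [y^3 - 3 y^2 + v] has a double root. *)

(** * Rational maps in homogeneous coordinates *)

Section ProjectiveLine.
Variable F : fieldType.
Implicit Types (x y k : F) (P : option F) (p q : {poly F}).

Definition nz x y := (x != 0) || (y != 0).

Definition pt x y : option F := if y == 0 then None else Some (x / y).

Lemma ptP P : exists x y, nz x y /\ P = pt x y.
Proof.
case: P => [x|]; last by exists 1, 0; rewrite /nz /pt eqxx oner_eq0.
by exists x, 1; rewrite /nz /pt oner_eq0 orbT divr1.
Qed.

Lemma pt_eq x y x' y' : nz x y -> nz x' y' ->
  pt x y = pt x' y' <-> x * y' = x' * y.
Proof.
rewrite /nz /pt; have [->|y0] := eqVneq y 0; have [->|y'0] := eqVneq y' 0;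
  rewrite ?orbF ?orbT => n1 n2.
- by rewrite !mulr0.
- split=> // /eqP; rewrite mulr0 mulf_eq0 (negPf y'0) orbF.
  by rewrite (negPf n1).
- split=> // /esym/eqP; rewrite mulr0 mulf_eq0 (negPf y0) orbF.
  by rewrite (negPf n2).
- split=> [[/eqP]|e]; first by rewrite eqr_div // => /eqP.
  by congr Some; apply/eqP; rewrite eqr_div // e.
Qed.

Lemma nzM k x y : k != 0 -> nz (k * x) (k * y) = nz x y.
Proof. by move=> k0; rewrite /nz !mulf_eq0 !(negPf k0). Qed.

Lemma ptM k x y : k != 0 -> pt (k * x) (k * y) = pt x y.
Proof.
move=> k0; rewrite /pt mulf_eq0 (negPf k0) /=; case: eqP => // _.
by rewrite -mulf_div divff // mul1r.
Qed.

(** Homogenisation in degree [n], the degree of the map rather than of [p], so that numerator and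
    denominator become forms of the same degree. *)
Definition hform (n : nat) p x y : F := \sum_(i < n.+1) p`_i * x ^+ i * y ^+ (n - i).

Lemma hformE n p x y : (size p <= n.+1)%N -> y != 0 ->
  hform n p x y = y ^+ n * p.[x / y].
Proof.
move=> sp y0; rewrite (horner_coef_wide _ sp) mulr_sumr; apply: eq_bigr => i _.
have le_in : (i <= n)%N by rewrite -ltnS.
have yi0 : y ^+ i != 0 by rewrite expf_neq0.
have -> : y ^+ n = y ^+ (n - i) * y ^+ i by rewrite -exprD subnK.
by rewrite expr_div_n; field.
Qed.

Lemma hform_y0 n p x : hform n p x 0 = p`_n * x ^+ n.
Proof.
rewrite /hform big_ord_recr /= subnn mulr1 big1 ?add0r // => i _.
by rewrite expr0n subn_eq0 leqNgt ltn_ord /= mulr0.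
Qed.

Lemma rf_deg_size (f : {poly F} * {poly F}) n : rf_deg f = n ->
  (size f.1 <= n.+1)%N /\ (size f.2 <= n.+1)%N.
Proof.
move=> <-; have := leq_maxl (size f.1).-1 (size f.2).-1.
have := leq_maxr (size f.1).-1 (size f.2).-1.
rewrite -[maxn _ _]/(rf_deg f).
by case: (size f.1) => [|a]; case: (size f.2) => [|b].
Qed.

(** Coprimality excludes a common finite zero; at oo, one of the two polynomials has degree exactly
    [n]. *)
Lemma hform_nz f n x y : (0 < n)%N -> rf_valid f -> rf_deg f = n -> nz x y ->
  nz (hform n f.1 x y) (hform n f.2 x y).
Proof.
move=> n0 /andP[q0 cop] dn; rewrite /nz.
have [s1 s2] := rf_deg_size dn.
have [->|y0] := eqVneq y 0.
  rewrite orbF !hform_y0 => x0; rewrite !mulf_eq0 expf_eq0 (negPf x0) andbF !orbF.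
  rewrite -negb_and; apply/negP => /andP[/eqP a0 /eqP b0].
  have lt p : (size p <= n.+1)%N -> p`_n = 0 -> ((size p).-1 < n)%N.
    move=> sp pn; have [->|p0] := eqVneq p 0; first by rewrite size_poly0.
    rewrite ltn_neqAle; apply/andP; split.
      apply: contraNneq p0 => e; rewrite -lead_coef_eq0 /lead_coef e; exact/eqP.
    by case: (size p) sp.
  have : (rf_deg f < n)%N by rewrite gtn_max !lt.
  by rewrite dn ltnn.
move=> _; rewrite !hformE // !mulf_eq0 expf_eq0 (negPf y0) andbF /= -negb_and.
apply/negP => /andP[r1 r2].
by have := coprimep_root cop r1; rewrite r2.
Qed.

Lemma rf_eval_pt f n x y : (0 < n)%N -> rf_valid f -> rf_deg f = n -> nz x y ->
  rf_eval f (pt x y) = pt (hform n f.1 x y) (hform n f.2 x y).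
Proof.
move=> n0 vf dn nxy; have nh := hform_nz n0 vf dn nxy.
have [s1 s2] := rf_deg_size dn.
move: nxy; rewrite /nz {1}/pt; have [y0|y0] := eqVneq y 0.
  rewrite orbF => x0; have xn : x ^+ n != 0 by rewrite expf_neq0.
  move: nh; rewrite y0 !hform_y0 (mulrC f.1`_n) (mulrC f.2`_n) nzM // ptM // /nz /pt /= => nh.
  have big p : (size p <= n.+1)%N -> p`_n != 0 -> size p = n.+1.
    move=> sp pn; apply/eqP; rewrite eqn_leq sp ltnNge /=.
    by apply: contraNN pn => sp'; rewrite nth_default.
  have small p : (size p <= n.+1)%N -> p`_n == 0 -> (size p < n.+1)%N.
    move=> sp pn; rewrite ltn_neqAle sp andbT; apply: contraTneq pn => e.
    have p0 : p != 0 by rewrite -size_poly_gt0 e.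
    by move: p0; rewrite -lead_coef_eq0 /lead_coef e.
  have [b0|b0] := eqVneq f.2`_n 0.
    move: nh; rewrite b0 eqxx orbF => a0.
    by rewrite (big _ s1 a0) small // b0.
  rewrite (big _ s2 b0) ltnNge s1 /=.
  have [a0|a0] := eqVneq f.1`_n 0.
    by rewrite ltn_eqF ?small ?a0 // mul0r.
  by rewrite (big _ s1 a0) eqxx /lead_coef (big _ s1 a0) (big _ s2 b0).
move=> _ /=; rewrite /pt !hformE // mulf_eq0 expf_eq0 (negPf y0) andbF /=.
case: eqP => // _; rewrite -mulf_div divff ?mul1r // expf_neq0 //.
Qed.

Lemma hform1E p x y : hform 1 p x y = p`_0 * y + p`_1 * x.
Proof. by rewrite /hform !big_ord_recl big_ord0 /= !mulr1 addr0 expr1. Qed.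

Lemma hform2E p x y :
  hform 2 p x y = p`_0 * y ^+ 2 + p`_1 * x * y + p`_2 * x ^+ 2.
Proof. by rewrite /hform !big_ord_recl big_ord0 /= !mulr1 !expr1 addr0 addrA. Qed.

End ProjectiveLine.

(** * A 2-periodic critical point and an automorphism force zero divergence *)

Section CriticalTwoCycle.
Variable F : numFieldType.

Lemma nz_lin (a b c d s t : F) : a * d - b * c != 0 -> nz s t ->
  nz (s * a + t * c) (s * b + t * d).
Proof.
move=> det; rewrite /nz -!negb_and; apply: contra => /andP[/eqP e1 /eqP e2].
have hs : s * (a * d - b * c) = 0.
  by transitivity ((s * a + t * c) * d - (s * b + t * d) * c); [ring|rewrite e1 e2; ring].
have ht : t * (a * d - b * c) = 0.
  by transitivity ((s * b + t * d) * a - (s * a + t * c) * b); [ring|rewrite e1 e2; ring].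
by move/eqP: hs; move/eqP: ht; rewrite !mulf_eq0 (negPf det) !orbF => -> ->.
Qed.

(** Suppose [g <> 0]. An automorphism fixing the critical point [U 1 0] fixes its image [U 0 1],
    hence is diagonal, and comparing coefficients makes it the identity. Otherwise it moves [U 1 0]
    to the second critical point, where [2 s + g t = 0]; following this point through its 2-cycle
    gives [8 c = g ^+ 3], and then [U 0 1] and [U 1 0] have the same image under [sigma]. *)
Lemma swapped_critical (U : F -> F -> option F) (phi sigma : option F -> option F)
    (c g m11 m12 m21 m22 : F) :
  (forall s t s' t', nz s t -> nz s' t' -> U s t = U s' t' <-> s * t' = s' * t) ->
  (forall P, exists s t, nz s t /\ P = U s t) ->
  c != 0 -> m11 * m22 - m12 * m21 != 0 ->
  (forall s t, nz s t -> phi (U s t) = U (c * t ^+ 2) (s ^+ 2 + g * s * t)) ->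
  (forall s t, nz s t -> sigma (U s t) = U (s * m11 + t * m12) (s * m21 + t * m22)) ->
  (forall P, sigma (phi P) = phi (sigma P)) ->
  (exists P, sigma P <> P) -> g = 0.
Proof.
move=> UE US c0 det phiE sE comm [P0 moved].
have nz10 : nz (1 : F) 0 by rewrite /nz oner_eq0.
have nz01 : nz (0 : F) 1 by rewrite /nz oner_eq0 orbT.
have nzm s t : nz s t -> nz (s * m11 + t * m12) (s * m21 + t * m22).
  by move=> nst; apply: nz_lin => //; rewrite mulrC (mulrC m21) [X in X - _]mulrC.
have nzphi s t : nz s t -> nz (c * t ^+ 2) (s ^+ 2 + g * s * t).
  rewrite /nz mulf_eq0 (negPf c0) expf_eq0 /=; have [->|//] := eqVneq t 0.
  by rewrite mulr0 addr0 expf_eq0 /= orbF.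
have sinj s t s' t' : nz s t -> nz s' t' ->
    sigma (U s t) = sigma (U s' t') -> s * t' = s' * t.
  move=> n n'; rewrite !sE // UE; [|exact: nzm..] => e.
  apply/eqP; rewrite -subr_eq0 -(inj_eq (mulfI det)) mulr0; apply/eqP.
  transitivity ((s * m11 + t * m12) * (s' * m21 + t' * m22)
     - (s' * m11 + t' * m12) * (s * m21 + t * m22)); first by ring.
  by rewrite e subrr.
have s10 : sigma (U 1 0) = U m11 m21 by rewrite sE // !mul1r !mul0r !addr0.
have s01 : sigma (U 0 1) = U m12 m22 by rewrite sE // !mul1r !mul0r !add0r.
have p10 : phi (U 1 0) = U 0 1.
  by rewrite phiE // expr0n /= !mulr0 expr1n addr0.
have nm1 : nz m11 m21 by have := nzm _ _ nz10; rewrite !mul1r !mul0r !addr0.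
have nm2 : nz m12 m22 by have := nzm _ _ nz01; rewrite !mul1r !mul0r !add0r.
have p01 : phi (U 0 1) = U 1 0.
  by rewrite phiE // UE /nz ?oner_eq0 ?expr1n ?mulr1 ?c0 //; ring.
have [m21z|m21nz] := eqVneq m21 0.
  have m11nz : m11 != 0 by move: nm1; rewrite /nz m21z eqxx orbF.
  have m12z : m12 = 0.
    have := comm (U 1 0); rewrite p10 s01 s10 m21z phiE; last by rewrite /nz m11nz.
    rewrite UE //; last by rewrite /nz expr0n /= !mulr0 addr0 expf_eq0 /= m11nz orbT.
    rewrite expr0n /= !mulr0 !mul0r addr0 => /eqP.
    by rewrite mulf_eq0 expf_eq0 /= (negPf m11nz) orbF => /eqP.
  have m22nz : m22 != 0 by move: nm2; rewrite /nz m12z eqxx.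
  have key s : m11 * (m11 ^+ 2 * s ^+ 2 + g * m11 * m22 * s) = m22 ^+ 3 * (s ^+ 2 + g * s).
    have ns1 : nz s 1 by rewrite /nz oner_eq0 orbT.
    have nsm : nz (s * m11) m22 by rewrite /nz m22nz orbT.
    have := comm (U s 1); rewrite phiE // !sE //; last exact: nzphi.
    rewrite m12z m21z !(mulr0, mul0r, add0r, addr0, mul1r, mulr1, expr1n).
    rewrite phiE // UE; first last.
    - exact: nzphi.
    - by rewrite /nz mulf_eq0 (negPf c0) (negPf m11nz).
    move=> e; apply: (mulfI c0).
    transitivity (c * m11 * ((s * m11) ^+ 2 + g * (s * m11) * m22)); first by ring.
    by rewrite e; ring.
  apply/eqP; apply/negP => /negP gnz; apply: moved.
  have k1 := key 1; have k2 := key (-1).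
  have two0 : (2 : F) != 0 by rewrite pnatr_eq0.
  have e3 : m11 ^+ 3 = m22 ^+ 3.
    apply: (mulfI two0).
    transitivity (m11 * (m11 ^+ 2 * 1 ^+ 2 + g * m11 * m22 * 1) +
       m11 * (m11 ^+ 2 * (-1) ^+ 2 + g * m11 * m22 * (-1))); first by ring.
    by rewrite k1 k2; ring.
  have e2 : m11 ^+ 2 = m22 ^+ 2.
    have gm : 2 * g * m22 != 0 by rewrite !mulf_neq0.
    apply: (mulfI gm).
    transitivity (m11 * (m11 ^+ 2 * 1 ^+ 2 + g * m11 * m22 * 1) -
       m11 * (m11 ^+ 2 * (-1) ^+ 2 + g * m11 * m22 * (-1))); first by ring.
    by rewrite k1 k2; ring.
  have e1 : m11 = m22.
    have m2 : m22 ^+ 2 != 0 by rewrite expf_neq0.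
    by apply: (mulIf m2); rewrite -{1}e2 -!exprS.
  have [s [t [nst ->]]] := US P0.
  rewrite sE // m12z m21z e1 UE //; first by ring.
  by rewrite !mulr0 addr0 add0r ![_ * m22]mulrC nzM.
have C : 2 * m11 = - g * m21.
  (* The involution [(s : t) -> (- s - g t : t)] preserves the fibres of the map and sends
     [(m11 : m21)] to [(z1 : m21)]. Pulled back by [sigma], the latter has the same image as
     [U 1 0], whose fibre is a single point; so the involution fixes [(m11 : m21)]. *)
  set z1 := - g * m21 - m11.
  set det' := m11 * m22 - m12 * m21 in det.
  pose s := (m22 * z1 - m12 * m21) / det'.
  pose t := (m11 * m21 - m21 * z1) / det'.
  have es : s * m11 + t * m12 = z1 by rewrite /s /t /det'; field.
  have et : s * m21 + t * m22 = m21 by rewrite /s /t /det'; field.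
  have nst : nz s t.
    rewrite /nz -negb_and; apply/negP => /andP[/eqP s0 /eqP t0].
    by move: et m21nz; rewrite s0 t0 !mul0r addr0 => <-; rewrite eqxx.
  have nz1 : nz z1 m21 by rewrite /nz m21nz orbT.
  have e : sigma (phi (U s t)) = sigma (phi (U 1 0)).
    rewrite !comm s10 sE // es et !phiE //; congr U; rewrite /z1; ring.
  move: e; rewrite phiE // p10 => /sinj - /(_ (nzphi _ _ nst) nz01).
  rewrite mulr1 mul0r => /eqP; rewrite mulf_eq0 (negPf c0) expf_eq0 /= => /eqP t0.
  have : m21 * z1 = m21 * m11.
    by move/eqP: t0; rewrite mulf_eq0 invr_eq0 (negPf det) orbF subr_eq0 mulrC => /eqP ->; rewrite mulrC.
  move/(mulfI m21nz); rewrite /z1 => e.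
  by rewrite mulr_natl mulr2n -{1}e subrK.
apply/eqP; apply/negP => /negP gnz.
have two0 : (2 : F) != 0 by rewrite pnatr_eq0.
pose k := - m21 / 2.
have k0 : k != 0 by rewrite mulf_neq0 ?oppr_eq0 // invr_eq0.
have Dm21 : m21 = - 2 * k by rewrite /k; field.
have Dm11 : m11 = g * k by apply: (mulfI two0); rewrite C /k; field.
have sQ : sigma (U 0 1) = U (c * m21 ^+ 2) (m11 ^+ 2 + g * m11 * m21).
  by rewrite -p10 comm s10 phiE.
have nq := nzphi _ _ nm1.
have := comm (U 0 1); rewrite p01 s10 sQ phiE // UE //; last exact: nzphi.
rewrite Dm11 Dm21 => e.
have g8 : 8 * c = g ^+ 3.
  have nn : 2 * g * c * k ^+ 5 != 0 by rewrite mulf_neq0 ?expf_neq0 // !mulf_neq0.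
  apply/eqP; rewrite -subr_eq0 -(inj_eq (mulfI nn)) mulr0; apply/eqP.
  move/eqP: e; rewrite -subr_eq0 => /eqP <-; ring.
have : sigma (U 0 1) = sigma (U 1 0).
  rewrite sQ s10 UE // Dm11 Dm21.
  transitivity (- (8 * c) * k ^+ 3); first by ring.
  rewrite g8; ring.
by move/sinj => /(_ nz01 nz10)/eqP; rewrite mul0r mulr1 eq_sym oner_eq0.
Qed.

(** The [g i] are the coefficients of the quadratic form cutting out the fibre through [[x : y]]. A
    double zero makes both partial derivatives vanish, a condition uniform in finite points and
    oo. *)
Lemma rf_crit_form f (x y : F) : rf_valid f -> rf_deg f = 2%N -> nz x y ->
  rf_crit f (pt x y) ->
  let g i := hform 2 f.2 x y * f.1`_i - hform 2 f.1 x y * f.2`_i in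
  2 * g 2%N * x + g 1%N * y = 0 /\ g 1%N * x + 2 * g 0%N * y = 0.
Proof.
move=> vf df nxy.
have nh := @hform_nz _ f 2 x y isT vf df nxy.
have ev := @rf_eval_pt _ f 2 x y isT vf df nxy.
have [s1 s2] := rf_deg_size df.
move: nh ev; set h1 := hform 2 f.1 x y; set h2 := hform 2 f.2 x y => nh ev crit g.
have [k kE] : exists k, forall i, g i = k * (rf_fibre f (pt x y))`_i.
  rewrite /rf_fibre ev /pt; have [h0|h0] := eqVneq h2 0.
    by exists (- h1) => i; rewrite /g h0; ring.
  by exists h2 => i; rewrite /g coefB coefCM; field.
have sr : (size (rf_fibre f (pt x y)) <= 3)%N.
  rewrite /rf_fibre ev /pt; case: ifP => // _.
  rewrite (leq_trans (size_polyD _ _)) // geq_max s1 size_polyN mul_polyC.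
  exact: leq_trans (size_scale_leq _ _) s2.
move: crit; set r := rf_fibre _ _ in kE sr *; rewrite !kE {kE}.
have eqr : r = (r`_0)%:P + (r`_1)%:P * 'X + (r`_2)%:P * 'X^2.
  apply/polyP => i; rewrite !coefD coefCM coefX coefCM coefXn coefC.
  case: i => [|[|[|i]]] /=; rewrite ?mulr0 ?mulr1 ?addr0 ?add0r //.
  by rewrite nth_default // (leq_trans sr).
have [y0|y0] := eqVneq y 0.
  rewrite /rf_crit /pt y0 eqxx df => sz.
  have [-> ->] : r`_1 = 0 /\ r`_2 = 0.
    rewrite /r /pt y0 eqxx; split; apply: nth_default => //.
    exact: ltnW.
  by split; ring.
rewrite /rf_crit {1}/pt (negPf y0) => /dvdpP [q qE].
have dr : r = q * ('X - (x / y)%:P) ^+ 2 by rewrite -qE /r /pt (negPf y0).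
have r0 : r.[x / y] = 0 by rewrite dr hornerM horner_exp hornerXsubC subrr expr0n /= mulr0.
have r1 : r^`().[x / y] = 0.
  have : ('X - (x / y)%:P).[x / y] = 0 by rewrite hornerXsubC subrr.
  rewrite dr expr2 !derivM derivXsubC; move: ('X - _) => l l0.
  by rewrite !(hornerD, hornerM) l0; ring.
have {}r0 : r`_0 + r`_1 * x / y + r`_2 * x / y * x / y = 0.
  by move: r0; rewrite {1}eqr !hornerE.
have {}r1 : r`_1 + r`_2 * (x / y + x / y) = 0.
  by move: r1; rewrite {1}eqr !derivE !hornerE.
move: r`_0 r`_1 r`_2 r0 r1 => c0 c1 c2 r0 r1; split.
  by transitivity (k * y * (c1 + c2 * (x / y + x / y))); [field | rewrite r1 mulr0].
transitivity (k * y * (2 * (c0 + c1 * x / y + c2 * x / y * x / y) -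
   (x / y) * (c1 + c2 * (x / y + x / y)))); first by field.
by rewrite r0 r1; ring.
Qed.

Lemma pt_basis (a b c d : F) : a * d - b * c != 0 ->
  let U s t := pt (s * a + t * c) (s * b + t * d) in
  (forall s t s' t', nz s t -> nz s' t' -> U s t = U s' t' <-> s * t' = s' * t)
  /\ (forall P, exists s t, nz s t /\ P = U s t).
Proof.
move=> det U; split.
  move=> s t s' t' n n'; rewrite /U pt_eq; [|exact: nz_lin..].
  have e : (s * a + t * c) * (s' * b + t' * d) - (s' * a + t' * c) * (s * b + t * d)
    = (a * d - b * c) * (s * t' - s' * t) by ring.
  split=> [h|h]; apply/eqP; rewrite -subr_eq0.
    by rewrite -(inj_eq (mulfI det)) -e h subrr mulr0.
  by rewrite e h subrr mulr0.
move=> P; have [x [y [nxy ->]]] := ptP P.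
exists ((x * d - y * c) / (a * d - b * c)), ((y * a - x * b) / (a * d - b * c)).
split; last by rewrite /U; congr pt; field.
rewrite /nz -negb_and; apply: contraL nxy => /andP[/eqP e1 /eqP e2].
have x0 : x = 0.
  transitivity ((x * d - y * c) / (a * d - b * c) * a +
              (y * a - x * b) / (a * d - b * c) * c); first by field.
  by rewrite e1 e2 !mul0r addr0.
have y0 : y = 0.
  transitivity ((x * d - y * c) / (a * d - b * c) * b +
              (y * a - x * b) / (a * d - b * c) * d); first by field.
  by rewrite e1 e2 !mul0r addr0.
by rewrite /nz x0 y0 eqxx.
Qed.

(** The conclusion lists the two coefficients of the divergence of the homogeneous lift. In the
    basis formed by [P] and its image, [g = 0] turns the map into [(c t^2 : s^2)], which is
    divergence free; the divergence is a trace, so it vanishes in the original coordinates. Being a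
    linear form, it is tested on the two basis vectors. *)
Lemma crit_two_cycle_div_free (f sigma : {poly F} * {poly F}) P :
  rf_valid f -> rf_deg f = 2%N -> periodic (rf_eval f) 2 P -> rf_crit f P ->
  rf_valid sigma -> rf_deg sigma = 1%N ->
  (forall P, rf_eval sigma (rf_eval f P) = rf_eval f (rf_eval sigma P)) ->
  (exists P, rf_eval sigma P <> P) ->
  2 * f.1`_2 + f.2`_1 = 0 /\ f.1`_1 + 2 * f.2`_0 = 0.
Proof.
move=> vf df [_ [/= per2 /(_ 1%N isT) /= per1]] crit vs ds comm moved.
have [a [b [nab DP]]] := ptP P; rewrite {}DP in per2 per1 crit.
have [/= g1 g2] := rf_crit_form vf df nab crit.
have ev x y (n : nz x y) := @rf_eval_pt _ f 2 x y isT vf df n.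
have enz x y (n : nz x y) := @hform_nz _ f 2 x y isT vf df n.
have sv x y (n : nz x y) := @rf_eval_pt _ sigma 1 x y isT vs ds n.
have snz x y (n : nz x y) := @hform_nz _ sigma 1 x y isT vs ds n.
have nh := enz _ _ nab; have nhh := enz _ _ nh.
move: per1 per2; rewrite !ev // pt_eq // pt_eq //.
move: nh nhh g1 g2.
set h1 := hform 2 f.1 a b; set h2 := hform 2 f.2 a b => nh nhh g1 g2 /eqP ind per2.
have det : a * h2 - b * h1 != 0.
  by apply: contraNneq ind => /eqP; rewrite subr_eq0 mulrC [b * _]mulrC mulrC => /eqP ->; rewrite mulrC.
(* [c] is the ratio between the second image of the vector [(a, b)] and [(a, b)] itself. *)
have [c c0 [cE1 cE2]] : exists2 c, c != 0 &
    hform 2 f.1 h1 h2 = c * a /\ hform 2 f.2 h1 h2 = c * b.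
  have [a0|a0] := eqVneq a 0.
    have b0 : b != 0 by move: nab; rewrite /nz a0 eqxx.
    exists (hform 2 f.2 h1 h2 / b); last first.
      split; last by field.
      by apply: (mulIf b0); rewrite per2 a0; ring.
    have e1 : hform 2 f.1 h1 h2 = 0 by apply: (mulIf b0); rewrite per2 a0 !mul0r.
    by move: nhh; rewrite /nz e1 eqxx /= => ?; rewrite mulf_neq0 ?invr_eq0.
  exists (hform 2 f.1 h1 h2 / a); last first.
    split; first by field.
    by apply: (mulfI a0); rewrite -per2; field.
  have : hform 2 f.1 h1 h2 != 0.
    apply: contraTneq nhh => e1; move/eqP: per2; rewrite e1 mul0r eq_sym mulf_eq0 (negPf a0) /=.
    by move=> /eqP ->; rewrite /nz eqxx.
  by move=> ?; rewrite mulf_neq0 ?invr_eq0.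
(* Twice the polar form of [p] at [(a, b)] and [(h1, h2)]. Criticality makes the vector
   [(B f.1, B f.2)] proportional to [(h1, h2)], with ratio [g]. *)
pose B (p : {poly F}) := 2 * p`_2 * a * h1 + p`_1 * (a * h2 + b * h1) + 2 * p`_0 * b * h2.
have BQ : B f.1 * h2 = B f.2 * h1.
  apply/eqP; rewrite -subr_eq0; apply/eqP.
  have := congr2 (fun u w => h1 * u + h2 * w) g1 g2.
  by rewrite !mulr0 addr0 => <-; rewrite /B; ring.
have [g [gE1 gE2]] : exists g, B f.1 = g * h1 /\ B f.2 = g * h2.
  have [h0|h0] := eqVneq h1 0.
    have h20 : h2 != 0 by move: nh; rewrite /nz h0 eqxx.
    exists (B f.2 / h2); split; last by field.
    by apply: (mulIf h20); rewrite BQ h0; ring.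
  exists (B f.1 / h1); split; first by field.
  by apply: (mulIf h0); rewrite -BQ; field.
have [/= UE US] := pt_basis det.
pose U s t := pt (s * a + t * h1) (s * b + t * h2).
have phiE s t : nz s t -> rf_eval f (U s t) = U (c * t ^+ 2) (s ^+ 2 + g * s * t).
  move=> n; rewrite /U ev; last exact: nz_lin.
  have E p : hform 2 p (s * a + t * h1) (s * b + t * h2)
     = s ^+ 2 * hform 2 p a b + s * t * B p + t ^+ 2 * hform 2 p h1 h2.
    by rewrite !hform2E /B; ring.
  by rewrite !E gE1 gE2 cE1 cE2 -/h1 -/h2; congr pt; ring.
pose L1 x y := hform 1 sigma.1 x y; pose L2 x y := hform 1 sigma.2 x y.
set d := a * h2 - b * h1 in det.
pose m11 := (L1 a b * h2 - L2 a b * h1) / d.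
pose m21 := (a * L2 a b - b * L1 a b) / d.
pose m12 := (L1 h1 h2 * h2 - L2 h1 h2 * h1) / d.
pose m22 := (a * L2 h1 h2 - b * L1 h1 h2) / d.
have LE s t : L1 (s * a + t * h1) (s * b + t * h2) =
       (s * m11 + t * m12) * a + (s * m21 + t * m22) * h1
    /\ L2 (s * a + t * h1) (s * b + t * h2) =
       (s * m11 + t * m12) * b + (s * m21 + t * m22) * h2.
  by split; rewrite /m11 /m12 /m21 /m22 /L1 /L2 !hform1E /d; field.
have sE s t : nz s t -> rf_eval sigma (U s t) = U (s * m11 + t * m12) (s * m21 + t * m22).
  move=> n; rewrite /U sv; last exact: nz_lin.
  have [e1 e2] := LE s t.
  by rewrite -/(L1 _ _) -/(L2 _ _) e1 e2.
have mdet : m11 * m22 - m12 * m21 != 0.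
  apply/negP => /eqP m0.
  have bad s t : nz s t -> s * m11 + t * m12 = 0 -> s * m21 + t * m22 = 0 -> False.
    move=> n e1 e2; have := snz _ _ (nz_lin det n).
    have [E1 E2] := LE s t.
    by rewrite -/(L1 _ _) -/(L2 _ _) E1 E2 e1 e2 !mul0r addr0 /nz eqxx.
  have [n1|n1] := boolP (nz m12 m11).
    apply: (bad (- m12) m11); first by rewrite /nz oppr_eq0.
      by ring.
    by rewrite -m0; ring.
  move: n1; rewrite /nz negb_or !negbK => /andP[/eqP m12z /eqP m11z].
  have [n2|n2] := boolP (nz m22 m21).
    apply: (bad (- m22) m21); first by rewrite /nz oppr_eq0.
      by rewrite m12z m11z; ring.
    by ring.
  move: n2; rewrite /nz negb_or !negbK => /andP[/eqP m22z /eqP m21z].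
  apply: (bad 1 0); first by rewrite /nz oner_eq0.
    by rewrite m12z m11z; ring.
  by rewrite m22z m21z; ring.
have g0 : g = 0 := swapped_critical UE US c0 mdet phiE sE comm moved.
set D1 := 2 * f.1`_2 + f.2`_1; set D2 := f.1`_1 + 2 * f.2`_0.
(* [tr(A) om(P,Q) = om(AP,Q) + om(P,AQ)] for the polar form [A = 2 Phi(P,.)], then for [2 Phi(Q,.)] *)
have DP : (D1 * a + D2 * b) * d = 0.
  transitivity (2 * (hform 2 f.1 a b * h2 - hform 2 f.2 a b * h1) +
     (a * B f.2 - b * B f.1)).
    by rewrite !hform2E /D1 /D2 /d /B; ring.
  by rewrite gE1 gE2 g0 -/h1 -/h2; ring.
have DQ : (D1 * h1 + D2 * h2) * d = 0.
  transitivity ((B f.1 * h2 - B f.2 * h1) +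
     2 * (a * hform 2 f.2 h1 h2 - b * hform 2 f.1 h1 h2)).
    by rewrite /D1 /D2 /d /B !hform2E; ring.
  by rewrite cE1 cE2 BQ; ring.
move/eqP: DP; rewrite mulf_eq0 (negPf det) orbF => /eqP DP.
move/eqP: DQ; rewrite mulf_eq0 (negPf det) orbF => /eqP DQ.
split; apply: (mulIf det); rewrite mul0r.
  transitivity ((D1 * a + D2 * b) * h2 - (D1 * h1 + D2 * h2) * b); first by rewrite /d; ring.
  by rewrite DP DQ; ring.
transitivity ((D1 * h1 + D2 * h2) * a - (D1 * a + D2 * b) * h1); first by rewrite /d; ring.
by rewrite DP DQ; ring.
Qed.

End CriticalTwoCycle.

(** * Moebius maps and the family [psi] over Q *)

Lemma rf_map_valid f : rf_valid (rf_map f) = rf_valid f.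
Proof. by rewrite /rf_valid /= map_poly_eq0 coprimep_map. Qed.

Lemma rf_map_deg f : rf_deg (rf_map f) = rf_deg f.
Proof. by rewrite /rf_deg /= !size_map_poly. Qed.

Lemma mobius_valid (F : fieldType) (a b c d : F) : a * d - b * c != 0 ->
  let sigma := (a%:P * 'X + b%:P, c%:P * 'X + d%:P) in
  rf_valid sigma /\ rf_deg sigma = 1%N.
Proof.
move=> det sigma.
have sz (k l : F) : size (k%:P * 'X + l%:P) = if k == 0 then (l != 0 : nat) else 2%N.
  by rewrite size_MXaddC polyC_eq0; case: (k =P 0) => [->|/eqP k0] /=;
    rewrite ?size_poly0 ?size_polyC ?k0 //; case: eqP.
split.
  rewrite /rf_valid /= -size_poly_eq0 sz; apply/andP; split.
    apply: contraNneq det; case: eqP => // ->; case: eqP => // -> _.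
    by rewrite !mulr0 subrr.
  apply/coprimepP => e e1 e2.
  have : e %| (a * d - b * c)%:P.
    have -> : (a * d - b * c)%:P =
        a%:P * (c%:P * 'X + d%:P) - c%:P * (a%:P * 'X + b%:P) :> {poly F}.
      by rewrite polyCB !polyCM; ring.
    by rewrite dvdp_sub // dvdp_mull.
  move/dvdp_trans => h; rewrite -size_poly_eq1 -dvdp1; apply: h.
  by rewrite dvdp1 size_polyC det.
rewrite /rf_deg /= !sz; case: (a =P 0) => [a0|_]; case: (c =P 0) => [c0|_] //=.
- by move: det; rewrite a0 c0 mul0r mulr0 subrr eqxx.
- by case: eqP.
- by case: eqP.
Qed.

Lemma dyn_mobius_pt (a b c d : rat) (s t : algC) : a * d - b * c != 0 -> nz s t ->
  dyn (a%:P * 'X + b%:P, c%:P * 'X + d%:P) (pt s t) =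
  pt (ratr a * s + ratr b * t) (ratr c * s + ratr d * t).
Proof.
move=> /mobius_valid[vs ds] n.
rewrite /dyn (@rf_eval_pt _ _ 1) ?rf_map_valid ?rf_map_deg //.
rewrite !hform1E !coef_map /= !(coefD, coefCM, coefC, coefX) /=.
by rewrite !(mulr0, mulr1, addr0, add0r) ![ratr _ * t + _]addrC.
Qed.

Lemma psi_valid v : v != 0 -> v != 4 -> rf_valid (psi v) /\ rf_deg (psi v) = 2%N.
Proof.
move=> v0 v4.
have s1 : size ('X *+ 2 - 1 : {poly rat}) = 2%N.
  rewrite -mulr_natl -polyC_natr -polyCN [_ * _]mul_polyC.
  by rewrite size_polyDl ?size_scale ?size_polyX // size_polyC.
have s2 : size (v *: 'X ^+ 2 - 1 : {poly rat}) = 3%N.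
  by rewrite size_polyDl ?size_scale ?size_polyXn // size_polyN size_poly1.
split; last by rewrite /rf_deg /= s1 s2.
rewrite /rf_valid /= -size_poly_eq0 s2 /=.
apply/coprimepP => e e1 e2.
(* At [v = 4] the denominator acquires the root 1/2 of the numerator; this is the Bezout identity
   behind it. *)
have : e %| (v - 4)%:P.
  have -> : (v - 4)%:P = 4 * (v *: 'X ^+ 2 - 1) - v%:P * ('X *+ 2 + 1) * ('X *+ 2 - 1) :> {poly rat}.
    by rewrite polyCB -mul_polyC; ring.
  by rewrite dvdp_sub // dvdp_mull.
move/dvdp_trans => h; rewrite -size_poly_eq1 -dvdp1; apply: h.
by rewrite dvdp1 size_polyC subr_eq0 v4.
Qed.

Lemma dyn_psi_pt v (s t : algC) : v != 0 -> v != 4 -> nz s t ->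
  dyn (psi v) (pt s t) = pt (2 * s * t - t ^+ 2) (ratr v * s ^+ 2 - t ^+ 2) /\
  nz (2 * s * t - t ^+ 2) (ratr v * s ^+ 2 - t ^+ 2).
Proof.
move=> v0 v4 n; have [vv dv] := psi_valid v0 v4.
have := @rf_eval_pt _ (rf_map (psi v)) 2 s t isT; rewrite rf_map_valid rf_map_deg.
have := @hform_nz _ (rf_map (psi v)) 2 s t isT; rewrite rf_map_valid rf_map_deg.
move=> /(_ vv dv n) nh /(_ vv dv n); rewrite /dyn => ->; move: nh.
have -> : hform 2 (rf_map (psi v)).1 s t = 2 * s * t - t ^+ 2.
  rewrite hform2E /= !coef_map /= !(coefD, coefMn, coefX, coefN, coef1) /=.
  by rewrite !rmorphB !rmorphMn ?rmorph0 ?rmorph1 /=; ring.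
have -> : hform 2 (rf_map (psi v)).2 s t = ratr v * s ^+ 2 - t ^+ 2.
  rewrite hform2E /= !coef_map /= !(coefD, coefZ, coefXn, coefN, coef1) /=.
  by rewrite !rmorphB !rmorphM ?rmorph0 ?rmorph1 /=; ring.
by [].
Qed.

(** * Covariants of binary cubics and reduction to [psi v] *)

Section BinaryCubic.
Variables (K : numFieldType) (a b c d : K).

(* The quadratic map [(F_Y : - F_X)] (up to the factor 3) of the binary cubic
   [F = a X^3 + 3 b X^2 Y + 3 c X Y^2 + d Y^3]. *)
Definition grad1 x y := b * x ^+ 2 + 2 * c * x * y + d * y ^+ 2.
Definition grad2 x y := - (a * x ^+ 2 + 2 * b * x * y + c * y ^+ 2).

Definition cubic x y := a * x ^+ 3 + 3 * b * x ^+ 2 * y + 3 * c * x * y ^+ 2 + d * y ^+ 3.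
(** Up to constant factors, [hess] and [tcov] are the Hessian and the cubic covariant of [F].
    [cdisc] is the discriminant of [hess], and [- 27 * cdisc] is that of [F]. *)
Definition hess x y :=
  (a * c - b ^+ 2) * x ^+ 2 + (a * d - b * c) * x * y + (b * d - c ^+ 2) * y ^+ 2.
Definition tcov x y :=
  (a ^+ 2 * d - 3 * a * b * c + 2 * b ^+ 3) * x ^+ 3
  + 3 * (a * b * d + b ^+ 2 * c - 2 * a * c ^+ 2) * x ^+ 2 * y
  - 3 * (a * c * d + b * c ^+ 2 - 2 * b ^+ 2 * d) * x * y ^+ 2
  - (a * d ^+ 2 - 3 * b * c * d + 2 * c ^+ 3) * y ^+ 3.
Definition cdisc := (a * d - b * c) ^+ 2 - 4 * (a * c - b ^+ 2) * (b * d - c ^+ 2).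

(** This and the next two identities factor the determinants of the pairs among a point, its image
    and its second image. Where [cubic], [hess] and [tcov] are nonzero, the three points are
    distinct. *)
Lemma grad_cubic x y : x * grad2 x y - y * grad1 x y = - cubic x y.
Proof. by rewrite /grad1 /grad2 /cubic; ring. Qed.

Lemma grad2_cubic x y :
  x * grad2 (grad1 x y) (grad2 x y) - y * grad1 (grad1 x y) (grad2 x y)
  = - (cubic x y * hess x y).
Proof. by rewrite /grad1 /grad2 /cubic /hess; ring. Qed.

Lemma grad3_cubic x y :
  grad1 x y * grad2 (grad1 x y) (grad2 x y) - grad2 x y * grad1 (grad1 x y) (grad2 x y)
  = cubic x y * tcov x y.
Proof. by rewrite /grad1 /grad2 /cubic /tcov; ring. Qed.

(** If the discriminant vanishes, a multiple root of [F] is a common zero of its partial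
    derivatives. The three candidates are the double root of the Hessian, the triple root
    [(b : - a)] when that formula degenerates, and [(1 : 0)] when [a = b = 0]. *)
Lemma cdisc_neq0 :
  (forall x y, nz x y -> nz (grad1 x y) (grad2 x y)) -> cdisc != 0.
Proof.
move=> ndeg; apply/negP => /eqP D0.
have bad x y : nz x y -> grad1 x y = 0 -> grad2 x y = 0 -> False.
  by move=> /ndeg + e1 e2; rewrite /nz e1 e2 eqxx.
have [n|] := boolP (nz (- (a * d - b * c)) (2 * (a * c - b ^+ 2))).
  apply: (bad _ _ n).
    by rewrite -[RHS](mulr0 b) -D0 /cdisc /grad1; ring.
  by rewrite -[RHS](mulr0 (- a)) -D0 /cdisc /grad2; ring.
rewrite /nz negb_or !negbK oppr_eq0 mulf_eq0 pnatr_eq0 /= !subr_eq0.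
move=> /andP[/eqP e1 /eqP e2].
have [n|] := boolP (nz b (- a)).
  apply: (bad _ _ n).
    transitivity (b * (b ^+ 2 - a * c) + a * (a * d - b * c)); first by rewrite /grad1; ring.
    by rewrite e1 e2; ring.
  transitivity (a * (b ^+ 2 - a * c)); first by rewrite /grad2; ring.
  by rewrite e2; ring.
rewrite /nz negb_or !negbK oppr_eq0 => /andP[/eqP b0 /eqP a0].
by apply: (bad 1 0); rewrite /nz ?oner_eq0 // /grad1 /grad2 ?a0 b0; ring.
Qed.

(** The left side is the discriminant of the form [tcov], so [tcov] is not identically zero when
    [cdisc] is nonzero. *)
Lemma tcov_disc :
  let A := a ^+ 2 * d - 3 * a * b * c + 2 * b ^+ 3 in
  let B := 3 * (a * b * d + b ^+ 2 * c - 2 * a * c ^+ 2) in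
  let C := - (3 * (a * c * d + b * c ^+ 2 - 2 * b ^+ 2 * d)) in
  let E := - (a * d ^+ 2 - 3 * b * c * d + 2 * c ^+ 3) in
  B ^+ 2 * C ^+ 2 - 4 * A * C ^+ 3 - 4 * B ^+ 3 * E - 27 * A ^+ 2 * E ^+ 2
  + 18 * A * B * C * E = - (27 * cdisc ^+ 3).
Proof. by rewrite /= /cdisc; ring. Qed.

End BinaryCubic.

Lemma non_root (p : {poly rat}) : p != 0 -> exists x, p.[x] != 0.
Proof.
move=> p0; pose s := [seq i%:R : rat | i <- iota 0 (size p)].
have us : uniq s by rewrite map_inj_uniq ?iota_uniq // => i j /eqP; rewrite eqr_nat => /eqP.
have [/(max_poly_roots p0) /(_ us)|/allPn[x _ nx]] := boolP (all (root p) s).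
  by rewrite size_map size_iota ltnn.
by exists x.
Qed.

Lemma generic_point (a b c d : rat) : cdisc a b c d != 0 ->
  exists x, [/\ cubic a b c d x 1 != 0, hess a b c d x 1 != 0 & tcov a b c d x 1 != 0].
Proof.
move=> D0.
pose r3 (k0 k1 k2 k3 : rat) := Poly [:: k0; k1; k2; k3].
have r3E k0 k1 k2 k3 x : (r3 k0 k1 k2 k3).[x] = k0 + k1 * x + k2 * x ^+ 2 + k3 * x ^+ 3.
  by rewrite horner_Poly /=; ring.
have r3z k0 k1 k2 k3 : r3 k0 k1 k2 k3 = 0 -> [/\ k0 = 0, k1 = 0, k2 = 0 & k3 = 0].
  move=> e; have h i : (r3 k0 k1 k2 k3)`_i = 0 by rewrite e coef0.
  by split; [have := h 0%N|have := h 1%N|have := h 2%N|have := h 3%N]; rewrite coef_Poly.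
pose f := r3 d (3 * c) (3 * b) a.
pose g := r3 (b * d - c ^+ 2) (a * d - b * c) (a * c - b ^+ 2) 0.
pose h := r3 (- (a * d ^+ 2 - 3 * b * c * d + 2 * c ^+ 3))
  (- (3 * (a * c * d + b * c ^+ 2 - 2 * b ^+ 2 * d)))
  (3 * (a * b * d + b ^+ 2 * c - 2 * a * c ^+ 2))
  (a ^+ 2 * d - 3 * a * b * c + 2 * b ^+ 3).
have f0 : f != 0.
  apply: contraNneq D0 => /r3z[-> /eqP + /eqP + ->]; rewrite !mulf_eq0 !pnatr_eq0 /=.
  by move=> /eqP -> /eqP ->; rewrite /cdisc; apply/eqP; ring.
have g0 : g != 0.
  by apply: contraNneq D0 => /r3z[e1 e2 e3 _]; rewrite /cdisc e1 e2 e3; apply/eqP; ring.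
have h0 : h != 0.
  apply: contraNneq D0 => /r3z[e1 e2 e3 e4].
  have := tcov_disc a b c d; rewrite /= e1 e2 e3 e4 => /esym/eqP.
  rewrite !(expr0n, mulr0, mul0r, addr0, subr0) /= oppr_eq0 mulf_eq0 pnatr_eq0 /=.
  by rewrite expf_eq0.
have [x] : exists x, (f * g * h).[x] != 0 by apply: non_root; rewrite !mulf_neq0.
rewrite !hornerM !mulf_eq0 !negb_or !r3E -andbA => /and3P[x1 x2 x3].
exists x; split.
- by move: x1; congr (_ != 0); rewrite /cubic; ring.
- by move: x2; congr (_ != 0); rewrite /hess; ring.
- by move: x3; congr (_ != 0); rewrite /tcov; ring.
Qed.

(* In the basis [P], [Q = grad P] with [grad Q = u' P - u Q], vanishing of the divergence
   forces the mixed term of [grad (s P + t Q)] to be [2 u s t P]. *)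
Lemma grad_conj (K : numFieldType) (a b c d x y u u' al v s t : K) :
  let G1 := grad1 b c d in let G2 := grad2 a b c in
  let h1 := G1 x y in let h2 := G2 x y in
  x * h2 - y * h1 != 0 -> u != 0 ->
  G1 h1 h2 = u' * x - u * h1 -> G2 h1 h2 = u' * y - u * h2 ->
  al * u = - u' -> v * u ^+ 3 = u' ^+ 2 ->
  let X := s * (al * x) + t * h1 in let Y := s * (al * y) + t * h2 in
  let z1 := 2 * s * t - t ^+ 2 in let z2 := v * s ^+ 2 - t ^+ 2 in
  G1 X Y = u * (z1 * (al * x) + z2 * h1) /\
  G2 X Y = u * (z1 * (al * y) + z2 * h2).
Proof.
move=> G1 G2 h1 h2 det u0 k1 k2 eal ev X Y z1 z2.
pose B1 := 2 * (b * x * h1 + c * (x * h2 + y * h1) + d * y * h2).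
pose B2 := - (2 * (a * x * h1 + b * (x * h2 + y * h1) + c * y * h2)).
have BE1 : B1 = 2 * u * x.
  apply: (mulIf det).
  transitivity (- 2 * x * (x * G2 h1 h2 - y * G1 h1 h2)).
    by rewrite /B1 /h1 /h2 /G1 /G2 /grad1 /grad2; ring.
  by rewrite k1 k2; ring.
have BE2 : B2 = 2 * u * y.
  apply: (mulIf det).
  transitivity (- 2 * y * (x * G2 h1 h2 - y * G1 h1 h2)).
    by rewrite /B2 /h1 /h2 /G1 /G2 /grad1 /grad2; ring.
  by rewrite k1 k2; ring.
have Dal : al = - u' / u by rewrite -eal mulfK.
have Dv : v = u' ^+ 2 / u ^+ 3 by rewrite -ev mulfK // expf_neq0.
split.
  transitivity (s ^+ 2 * al ^+ 2 * h1 + s * t * al * B1 + t ^+ 2 * G1 h1 h2).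
    by rewrite /X /Y /B1 /h1 /h2 /G1 /G2 /grad1 /grad2; ring.
  by rewrite BE1 k1 /z1 /z2 Dal Dv; field.
transitivity (s ^+ 2 * al ^+ 2 * h2 + s * t * al * B2 + t ^+ 2 * G2 h1 h2).
  by rewrite /X /Y /B2 /h1 /h2 /G1 /G2 /grad1 /grad2; ring.
by rewrite BE2 k2 /z1 /z2 Dal Dv; field.
Qed.

Lemma cramer2 (K : fieldType) (x y h1 h2 k1 k2 : K) : x * h2 - y * h1 != 0 ->
  let D := x * h2 - y * h1 in
  let u := - (x * k2 - y * k1) / D in let u' := (k1 * h2 - k2 * h1) / D in
  k1 = u' * x - u * h1 /\ k2 = u' * y - u * h2.
Proof. by move=> D0 D u u'; split; rewrite /u /u' /D; field. Qed.

Lemma div_free_conj_psi phi : rf_valid phi -> rf_deg phi = 2%N ->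
  2 * phi.1`_2 + phi.2`_1 = 0 -> phi.1`_1 + 2 * phi.2`_0 = 0 ->
  exists v : rat, [/\ v != 0, v != 4 & lin_conj_Q phi (psi v)].
Proof.
move=> vf df d1 d2.
pose a := - phi.2`_2; pose b := phi.1`_2; pose c := - phi.2`_0; pose d := phi.1`_0.
have q1 : phi.2`_1 = - (2 * b) by apply/eqP; rewrite -subr_eq0 opprK addrC d1.
have p1 : phi.1`_1 = 2 * c by rewrite /c mulrN; apply/eqP; rewrite -subr_eq0 opprK d2.
have hE1 x y : hform 2 phi.1 x y = grad1 b c d x y by rewrite hform2E p1 /grad1 /d /b; ring.
have hE2 x y : hform 2 phi.2 x y = grad2 a b c x y.
  by rewrite hform2E q1 /grad2 /a /c; ring.
have ndeg x y : nz x y -> nz (grad1 b c d x y) (grad2 a b c x y).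
  by rewrite -hE1 -hE2; apply: hform_nz.
have [x [f0 h0 t0]] := generic_point (cdisc_neq0 ndeg).
set h1 := grad1 b c d x 1; set h2 := grad2 a b c x 1.
set k1 := grad1 b c d h1 h2; set k2 := grad2 a b c h1 h2.
pose D := x * h2 - 1 * h1.
have D0 : D != 0 by rewrite /D grad_cubic oppr_eq0.
(* Coordinates of the second image in the basis [P = (x, 1)], [Q = (h1, h2)]: it is [u' P - u Q].
   They are nonzero because the second image differs from [P] and from [Q]. *)
pose u := - (x * k2 - 1 * k1) / D; pose u' := (k1 * h2 - k2 * h1) / D.
have u0 : u != 0.
  by rewrite mulf_neq0 ?invr_eq0 // oppr_eq0 /k1 /k2 grad2_cubic oppr_eq0 mulf_neq0.
have u'0 : u' != 0.
  rewrite mulf_neq0 ?invr_eq0 // -opprB oppr_eq0 [k2 * _]mulrC [k1 * _]mulrC.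
  by rewrite /k1 /k2 grad3_cubic mulf_neq0.
(* [al] rescales [P] so that, after division by [u], the first coordinate of the map is
   [2 s t - t^2]; [v] is then the coefficient of [s^2] in the second. *)
pose al := - u' / u; pose v := u' ^+ 2 / u ^+ 3.
have al0 : al != 0 by rewrite mulf_neq0 ?oppr_eq0 ?invr_eq0.
have v0 : v != 0 by rewrite mulf_neq0 ?invr_eq0 ?expf_neq0.
have [ku1 ku2] : k1 = u' * x - u * h1 /\ k2 = u' * 1 - u * h2 := cramer2 k1 k2 D0.
have eal : al * u = - u' by rewrite /al; field.
have ev : v * u ^+ 3 = u' ^+ 2 by rewrite /v; field.
have det : al * x * h2 - al * 1 * h1 != 0.
  have -> : al * x * h2 - al * 1 * h1 = al * D by rewrite mulrBr !mulrA.
  exact: mulf_neq0.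
have v4 : v != 4.
  (* For [v = 4] the vector with coordinates [(1, 2)] would be sent to zero, against coprimality. *)
  apply/negP => /eqP e4.
  have [e1 e2] := grad_conj (K := rat) (x := x) (y := 1) 1 2 D0 u0 ku1 ku2 eal ev.
  have n12 : nz (1 : rat) 2 by rewrite /nz oner_eq0.
  have := ndeg _ _ (nz_lin det n12); rewrite -/h1 -/h2 in e1 e2 *; rewrite e1 e2 e4.
  by rewrite /nz; apply/negP; rewrite negb_or !negbK; apply/andP; split; apply/eqP; ring.
exists v; split=> //.
have det' : al * x * h2 - h1 * (al * 1) != 0 by rewrite [h1 * _]mulrC.
have [vs ds] := mobius_valid det'.
exists ((al * x)%:P * 'X + h1%:P, (al * 1)%:P * 'X + h2%:P); split=> //; split=> // P.
have [s [t [nst ->]]] := ptP P.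
have [-> npsi] := dyn_psi_pt v0 v4 nst.
pose R (z : rat) : algC := ratr z.
have sE s' t' : nz s' t' ->
    dyn ((al * x)%:P * 'X + h1%:P, (al * 1)%:P * 'X + h2%:P) (pt s' t') =
    pt (s' * (R al * R x) + t' * R h1) (s' * (R al * R 1) + t' * R h2).
  move=> n; rewrite (dyn_mobius_pt det') // /R -!rmorphM.
  by rewrite ![_ * s']mulrC ![_ * t']mulrC.
rewrite !sE //.
have Rdet : R al * R x * R h2 - R al * R 1 * R h1 != 0.
  by rewrite /R -!rmorphM -rmorphB fmorph_eq0.
rewrite /dyn (@rf_eval_pt _ _ 2) ?rf_map_valid ?rf_map_deg //; last exact: nz_lin.
have RE1 X Y : hform 2 (rf_map phi).1 X Y = grad1 (R b) (R c) (R d) X Y.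
  by rewrite hform2E /= !coef_map /= p1 /grad1 /R rmorphM rmorph_nat; ring.
have RE2 X Y : hform 2 (rf_map phi).2 X Y = grad2 (R a) (R b) (R c) X Y.
  by rewrite hform2E /= !coef_map /= q1 /grad2 /R !(rmorphN, rmorphM) rmorph_nat; ring.
have Rg1 X Y : R (grad1 b c d X Y) = grad1 (R b) (R c) (R d) (R X) (R Y).
  by rewrite /grad1 /R !(rmorphD, rmorphM, rmorphXn, rmorph1) /=.
have Rg2 X Y : R (grad2 a b c X Y) = grad2 (R a) (R b) (R c) (R X) (R Y).
  by rewrite /grad2 /R !(rmorphN, rmorphD, rmorphM, rmorphXn, rmorph1) /=.
have [||||||e1 e2] := @grad_conj algC (R a) (R b) (R c) (R d) (R x) (R 1) (R u) (R u') (R al) (R v) s t.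
- by rewrite -Rg1 -Rg2 /R -!rmorphM -rmorphB fmorph_eq0.
- by rewrite fmorph_eq0.
- by rewrite -!Rg1 -!Rg2 -Rg1 -/h1 -/h2 -/k1 ku1 /R rmorphB !rmorphM.
- by rewrite -!Rg1 -!Rg2 -/h1 -/h2 -/k2 ku2 /R rmorphB !rmorphM.
- by rewrite /R -rmorphM eal rmorphN.
- by rewrite /R -!rmorphXn -rmorphM ev.
move: e1 e2; rewrite -!Rg1 -!Rg2 -/h1 -/h2 => e1 e2.
by rewrite RE1 RE2 e1 e2 ptM // fmorph_eq0.
Qed.

(** * Automorphisms of the algebraic closure and of [Q3 phi] *)

(** The splitting field of the minimal polynomial is Galois with fixed field Q, so some element of
    its group moves [x], and that element extends to the algebraic closure. *)
Lemma moved_by_aut (x : algC) : x \notin Crat ->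
  exists nu : {rmorphism algC -> algC}, nu x != x.
Proof.
have [p [Dp mon_p] _] := minCpolyP x.
have [r Dr] := closed_field_poly_normal (minCpoly x).
have [Qs [QsC [s1 Ds1 gen]]] := num_field_exists r.
have Dp1 : map_poly (in_alg Qs) p = \prod_(z <- s1) ('X - z%:P).
  apply: (map_poly_inj QsC); rewrite rmorph_prod /= -map_poly_comp.
  rewrite (@eq_map_poly _ _ _ ratr) => [|a]; last by rewrite /= alg_num_field fmorph_rat.
  rewrite -Dp Dr (monicP (minCpoly_monic x)) scale1r -Ds1 big_map.
  by apply: eq_bigr => z _; rewrite rmorphB /= map_polyX map_polyC.
have split_p : splittingFieldFor 1 (map_poly (in_alg Qs) p) {:Qs}.
  by exists s1; rewrite ?Dp1 ?eqpxx.
have Qs_ax : FieldExt_isSplittingField _ Qs.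
  by constructor; exists (map_poly (in_alg Qs) p) => //; apply: alg_polyOver.
pose L : splittingFieldType rat := HB.pack_for (splittingFieldType rat) Qs Qs_ax.
have x_r : x \in r.
  by have := root_minCpoly x; rewrite Dr (monicP (minCpoly_monic x)) scale1r root_prod_XsubC.
have /mapP[x1 _ Dx] : x \in map QsC s1 by rewrite Ds1.
have galL : galois 1 {:L}.
  rewrite /galois sub1v normalFieldf andbT /=; apply/separableP => u _.
  by apply: pcharf0_separable => q; rewrite pchar_lalg pchar_num.
move=> xQ.
have : (x1 : L) \notin fixedField ('Gal({:L} / 1))%g.
  rewrite (galois_fixedField galL); apply: contra xQ => /vlineP[a Da].
  by rewrite Dx; apply/CratP; exists a; rewrite Da alg_num_field fmorph_rat.
have memx : (x1 : L) \in {:L}%VS by apply: memvf.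
move=> nfix; have [g gx] : exists g : gal_of {:L}, g x1 != x1.
  apply/existsP; apply: contraNT nfix => /existsPn fixx.
  by apply/(fixedFieldP memx) => g _; apply/eqP; have := fixx g; rewrite negbK.
have [nu Dnu] := @extend_algC_subfield_aut L QsC g.
by exists nu; rewrite Dx -Dnu (inj_eq (fmorph_inj _)).
Qed.

Lemma gen_field_sub (S K : algC -> Prop) : is_subfield K -> (forall s, S s -> K s) ->
  forall x, gen_field S x -> K x.
Proof. by move=> sK SK x; apply. Qed.

Lemma gen_field_subfield S : is_subfield (gen_field S).
Proof.
split; first by move=> K [].
split; first by move=> x y hx hy K sK SK; have [_ [h _]] := sK; apply: h; [exact: hx|exact: hy].
split; first by move=> x y hx hy K sK SK; have [_ [_ [h _]]] := sK; apply: h; [exact: hx|exact: hy].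
by move=> x hx K sK SK; have [_ [_ [_ h]]] := sK; apply: h; exact: hx.
Qed.

Section Subfield.
Variables (K : algC -> Prop) (sK : is_subfield K).

Lemma subfield1 : K 1. Proof. by case: sK. Qed.
Lemma subfieldB x y : K x -> K y -> K (x - y). Proof. by case: sK => _ [h _]; apply: h. Qed.
Lemma subfieldM x y : K x -> K y -> K (x * y). Proof. by case: sK => _ [_ [h _]]; apply: h. Qed.
Lemma subfieldV x : K x -> K x^-1. Proof. by case: sK => _ [_ [_ h]]; apply: h. Qed.
Lemma subfield0 : K 0. Proof. by rewrite -(subrr 1); apply: subfieldB; apply: subfield1. Qed.
Lemma subfieldD x y : K x -> K y -> K (x + y).
Proof.
move=> hx hy; rewrite -[y]opprK; apply: subfieldB => //; rewrite -sub0r.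
by apply: subfieldB => //; apply: subfield0.
Qed.
Lemma subfield_rat a : K (ratr a).
Proof.
have nat_ n : K n%:R.
  by elim: n => [|n IH]; [apply: subfield0 | rewrite -natr1; apply: subfieldD => //; apply: subfield1].
have int_ (z : int) : K z%:~R.
  case: z => n; first exact: nat_.
  by rewrite NegzE mulrNz -sub0r; apply: subfieldB; [apply: subfield0 | apply: nat_].
by rewrite /ratr; apply: subfieldM; [|apply: subfieldV]; apply: int_.
Qed.

Lemma subfield_gen (Qs : fieldExtType rat) (QsC : {rmorphism Qs -> algC}) s1 :
  (forall z, z \in s1 -> K (QsC z)) -> forall z, z \in <<1 & s1>>%VS -> K (QsC z).
Proof.
elim/last_ind: s1 => [|s a IH] Ks z.
  rewrite adjoin_nil subfield_closed => /vlineP[c ->].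
  by rewrite alg_num_field fmorph_rat; apply: subfield_rat.
have {}IH : forall z, z \in <<1 & s>>%VS -> K (QsC z).
  by apply: IH => y ys; apply: Ks; rewrite mem_rcons inE ys orbT.
have Ka : K (QsC a) by apply: Ks; rewrite mem_rcons inE eqxx.
rewrite adjoin_rcons => /Fadjoin_polyP[p /polyOverP pK ->].
rewrite horner_coef rmorph_sum /=.
elim/big_rec: _ => [|i y _ Ky]; first exact: subfield0.
apply: subfieldD => //; rewrite rmorphM rmorphXn; apply: subfieldM; first exact: IH.
elim: (nat_of_ord i) => [|n Kn]; first exact: subfield1.
by rewrite exprS; apply: subfieldM.
Qed.

End Subfield.

(** [f] is arbitrary outside the generated field. Since that field is a number field, the
    restriction of [f] transports to an endomorphism of an abstract number field, which extends to
    the algebraic closure. *)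
Lemma field_aut_extend (S : algC -> Prop) (s : seq algC) f :
  (forall x, S x <-> x \in s) -> field_aut (gen_field S) f ->
  exists nu : {rmorphism algC -> algC}, forall x, x \in s -> nu x = f x.
Proof.
move=> Ss; set K := gen_field _; have sK : is_subfield K := gen_field_subfield _.
case=> [fK [_ [fD [fM f1]]]].
have [Qs [QsC [s1 Ds1 gen]]] := num_field_exists s.
have Ks x : x \in s -> K x by move=> /Ss xs L sL; apply.
have QK z : K (QsC z).
  apply: (subfield_gen sK (s1 := s1)) => [y ys|]; last by rewrite gen memvf.
  by apply: Ks; rewrite -Ds1 map_f.
have KQ x : K x -> exists z, QsC z == x.
  move: x; apply: (@gen_field_sub _ (fun x => exists z, QsC z == x)) => [|y]; last first.
    by rewrite Ss -Ds1 => /mapP[z _ ->]; exists z.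
  split; first by exists 1; rewrite rmorph1.
  split; first by move=> x1 y [z /eqP <-] [t /eqP <-]; exists (z - t); rewrite rmorphB.
  split; first by move=> x1 y [z /eqP <-] [t /eqP <-]; exists (z * t); rewrite rmorphM.
  by move=> x1 [z /eqP <-]; exists (z^-1); rewrite fmorphV.
have ex z : exists t, QsC t == f (QsC z) by apply: KQ; apply: fK; apply: QK.
pose g z := xchoose (ex z).
have gE z : QsC (g z) = f (QsC z) by apply/eqP; apply: (xchooseP (ex z)).
have inj := fmorph_inj QsC.
have gB : zmod_morphism g.
  have f0 : f 0 = 0.
    by apply: (addrI (f 0)); rewrite -fD ?addr0 //; apply: subfield0.
  have gD x y : g (x + y) = g x + g y by apply: inj; rewrite rmorphD !gE rmorphD fD.
  have g0 : g 0 = 0 by apply: inj; rewrite gE rmorph0.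
  move=> x y; rewrite gD; congr (_ + _); apply: (addrI (g y)).
  by rewrite -gD !subrr.
have gM : monoid_morphism g.
  by split=> [|x y]; apply: inj; rewrite ?rmorphM !gE ?rmorph1 // rmorphM fM.
pose gZ := GRing.isZmodMorphism.Build _ _ g gB.
pose gR := GRing.isMonoidMorphism.Build _ _ g gM.
pose gRM : {rmorphism Qs -> Qs} := HB.pack g gZ gR.
have [nu Dnu] := extend_algC_subfield_aut QsC gRM.
exists nu => x; rewrite -Ds1 => /mapP[z _ ->].
by rewrite -Dnu /= gE.
Qed.

(* [G3_is] with automorphisms of [Qbar] in place of those of [Q3 phi]. *)
Definition G3bar_is (phi : {poly rat} * {poly rat}) (X : {group 'S_6} -> Prop) : Prop :=
  exists l, labels3 phi l /\
  exists H : {group 'S_6}, X H /\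
    (forall nu : {rmorphism algC -> algC},
       exists2 s, s \in H & forall i, omap nu (l i) = l (s i)) /\
    (forall s, s \in H ->
       exists nu : {rmorphism algC -> algC}, forall i, omap nu (l i) = l (s i)).

Lemma G3bar_G3 phi X : G3bar_is phi X -> G3_is phi X.
Proof.
case=> l [lab [H [XH [toH ofH]]]]; have [_ perl _] := lab.
exists l; split=> //; exists H; split=> //.
have Ss x : periodic (dyn phi) 3 (Some x) <-> x \in pmap l (enum 'I_6).
  rewrite mem_pmap perl; split=> [[i Di]|/mapP[i _ Di]]; last by exists i.
  by apply/mapP; exists i; rewrite ?mem_enum.
pose K := Q3 phi; have sK : is_subfield K := gen_field_subfield _.
split=> [f /(field_aut_extend Ss)[nu Dnu]|s Hs].
  have [s Hs ls] := toH nu; exists s => // i; rewrite -ls.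
  case Di: (l i) => [x|] //=; rewrite Dnu //; apply/Ss/perl; by exists i.
have [nu Dnu] := ofH s Hs.
(* An automorphism inducing the inverse permutation supplies preimages, whence surjectivity of [nu]
   on [Q3 phi]. *)
have [nu' Dnu'] := ofH _ (groupVr Hs).
have QnuP (mu : {rmorphism algC -> algC}) t :
    (forall i, omap mu (l i) = l (t i)) -> forall x, K x -> K (mu x).
  move=> Dmu; apply: (@gen_field_sub _ (fun x => K (mu x))) => [|x /perl[i Di]].
    split; first by rewrite rmorph1; apply: subfield1.
    split; first by move=> x y; rewrite rmorphB; apply: subfieldB.
    split; first by move=> x y; rewrite rmorphM; apply: subfieldM.
    by move=> x; rewrite fmorphV; apply: subfieldV.
  move=> L _; apply; apply/perl; exists (t i); by rewrite -Dmu Di.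
exists nu => //; split; first exact: QnuP Dnu.
split; last by split; [move=> *; apply: rmorphD | split; [move=> *; apply: rmorphM | apply: rmorph1]].
move=> y Ky; exists (nu' y); first exact: QnuP Dnu' _ Ky.
move: y Ky; apply: (@gen_field_sub _ (fun y => nu (nu' y) = y)) => [|x /perl[i Di]].
  split; first by rewrite !rmorph1.
  split; first by move=> x y hx hy; rewrite !rmorphB hx hy.
  split; first by move=> x y hx hy; rewrite !rmorphM hx hy.
  by move=> x hx; rewrite !fmorphV hx.
have := Dnu (s^-1 i)%g; rewrite -Dnu' permKV Di /= => -[//].
Qed.

Lemma dyn_aut phi (nu : {rmorphism algC -> algC}) P :
  dyn phi (omap nu P) = omap nu (dyn phi P).
Proof.
have hn (p : {poly rat}) x : (map_poly ratr p).[nu x] = nu (map_poly ratr p).[x].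
  rewrite -horner_map; congr _.[_]; rewrite -map_poly_comp.
  by apply: eq_map_poly => a /=; rewrite fmorph_rat.
case: P => [x|]; rewrite /dyn /rf_eval /=.
  by rewrite !hn fmorph_eq0; case: ifP => //= _; rewrite fmorph_div.
rewrite !size_map_poly !lead_coef_map; case: ifP => //= _.
by case: ifP => _ /=; rewrite ?rmorph0 // fmorph_div !fmorph_rat.
Qed.

Lemma deg1_det (F : fieldType) (f : {poly F} * {poly F}) :
  rf_valid f -> rf_deg f = 1%N -> f.1`_1 * f.2`_0 - f.2`_1 * f.1`_0 != 0.
Proof.
move=> vf df; apply/negP => /eqP D0.
have bad x y : nz x y -> f.1`_0 * y + f.1`_1 * x = 0 -> f.2`_0 * y + f.2`_1 * x = 0 -> False.
  by move=> /(@hform_nz _ f 1 x y isT vf df) + e1 e2; rewrite !hform1E e1 e2 /nz eqxx.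
have [n1|] := boolP (nz f.1`_0 (- f.1`_1)).
  apply: (bad _ _ n1); first by ring.
  transitivity (- (f.1`_1 * f.2`_0 - f.2`_1 * f.1`_0)); first by ring.
  by rewrite D0 oppr0.
rewrite /nz negb_or !negbK oppr_eq0 => /andP[/eqP b0 /eqP a0].
have [n2|] := boolP (nz f.2`_0 (- f.2`_1)).
  by apply: (bad _ _ n2); rewrite ?a0 ?b0; ring.
rewrite /nz negb_or !negbK oppr_eq0 => /andP[/eqP d0 /eqP c0].
by apply: (bad 1 0); rewrite ?a0 ?b0 ?c0 ?d0 /nz ?oner_eq0 //; ring.
Qed.

Lemma mobius_bij (F : numFieldType) (f : {poly F} * {poly F}) :
  rf_valid f -> rf_deg f = 1%N ->
  injective (rf_eval f) /\ forall P, exists Q, rf_eval f Q = P.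
Proof.
move=> vf df; have det := deg1_det vf df.
have [/= UE US] := pt_basis det.
have fE x y : nz x y ->
    rf_eval f (pt x y) = pt (x * f.1`_1 + y * f.1`_0) (x * f.2`_1 + y * f.2`_0).
  move=> n; rewrite (@rf_eval_pt _ f 1) // !hform1E; congr pt; ring.
split=> [P Q|P].
  have [x [y [n ->]]] := ptP P; have [x' [y' [n' ->]]] := ptP Q.
  by rewrite !fE // UE // pt_eq.
have [x [y [n ->]]] := US P; exists (pt x y); exact: fE.
Qed.

(** [sigma] is a bijection defined over Q, so it carries labels to labels and commutes with Galois;
    the same [H] serves both maps. *)
Lemma G3bar_lin_conj phi psi X : lin_conj_Q phi psi -> G3bar_is psi X -> G3bar_is phi X.
Proof.
case=> sigma [vs [ds conj]] [l [[linj lper ldyn] [H [XH [toH ofH]]]]].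
have [sinj ssurj] : injective (dyn sigma) /\ forall P, exists Q, dyn sigma Q = P.
  by apply: mobius_bij; rewrite ?rf_map_valid ?rf_map_deg.
have it n P : iter n (dyn phi) (dyn sigma P) = dyn sigma (iter n (dyn psi) P).
  by elim: n => //= n ->; rewrite conj.
have per P : periodic (dyn phi) 3 (dyn sigma P) <-> periodic (dyn psi) 3 P.
  rewrite /periodic it; split=> -[_ [e ne]]; split=> //; split.
  - exact: sinj.
  - by move=> m /ne; rewrite it => h e'; apply: h; rewrite e'.
  - by rewrite e.
  - by move=> m /ne h; rewrite it => /sinj.
exists (fun i => dyn sigma (l i)); split.
  split; first by move=> i j /sinj/linj.
    move=> P; have [Q <-] := ssurj P; rewrite per lper; split=> -[i e]; exists i.
      by rewrite e.
    exact: sinj.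
  by move=> i; rewrite -conj ldyn.
exists H; split=> //; split.
  move=> nu; have [s Hs e] := toH nu; exists s => // i; by rewrite -dyn_aut e.
move=> s /ofH[nu e]; exists nu => i; by rewrite -dyn_aut e.
Qed.

(** * Recognising the subgroups of [W] from a few elements *)

Section SubgroupsOfW.
Local Open Scope nat_scope.
Local Open Scope group_scope.

Definition seq6fun (r : seq nat) (i : 'I_6) : 'I_6 :=
  Ordinal (ltn_pmod (nth 0%N r i) (isT : (0 < 6)%N)).

Lemma j6fun_inj : injective (seq6fun [:: 2; 0; 1; 4; 5; 3]%N).
Proof.
apply: (@can_inj _ _ _ (seq6fun [:: 1; 2; 0; 5; 3; 4]%N)) => i; apply/val_inj.
by case: i => [[|[|[|[|[|[|?]]]]]] Hi].
Qed.

Lemma s6fun_inj : injective (seq6fun [:: 3; 4; 5; 0; 1; 2]%N).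
Proof.
apply: (@can_inj _ _ _ (seq6fun [:: 3; 4; 5; 0; 1; 2]%N)) => i; apply/val_inj.
by case: i => [[|[|[|[|[|[|?]]]]]] Hi].
Qed.

(* In terms of the labels [lab] below, [cyc6] is induced by [tau] on the roots of [p3], and
   [twist6], [swap6] by a rotation and a transposition of the fixed points of [psi v]. *)
Definition twist6 : 'S_6 := perm j6fun_inj.
Definition swap6 : 'S_6 := perm s6fun_inj.

Local Notation c := cyc6.
Local Notation j := twist6.
Local Notation s := swap6.

Local Ltac perm6 :=
  apply/permP => -[[|[|[|[|[|[|?]]]]]] ?] //; apply/val_inj;
  rewrite /cyc6 /twist6 /swap6 ?expgS ?expg0 ?permM ?perm1 ?permE //=.

Lemma c6X3 : c ^+ 3 = 1. Proof. by perm6. Qed.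
Lemma j6X3 : j ^+ 3 = 1. Proof. by perm6. Qed.
Lemma s6X2 : s ^+ 2 = 1. Proof. by perm6. Qed.
Lemma cj6C : commute c j. Proof. by rewrite /commute; perm6. Qed.
Lemma cs6C : commute c s. Proof. by rewrite /commute; perm6. Qed.
Lemma js6 : j ^ s = j^-1.
Proof.
have -> : j^-1 = j ^+ 2 by apply: (mulgI j); rewrite mulgV -expgS j6X3.
rewrite /conjg; have -> : s^-1 = s by apply: (mulgI s); rewrite mulgV -s6X2.
by perm6.
Qed.

Lemma memW_enum w : w \in W ->
  exists a b (e : bool), [/\ (a < 3)%N, (b < 3)%N & w = c ^+ a * j ^+ b * s ^+ e].
Proof.
move=> /cent1P wC.
have wc i : w (c i) = c (w i) by rewrite -!permM wC.
have val_c i : val (c i) = nth 0%N [:: 1; 2; 0; 4; 5; 3]%N i.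
  by rewrite permE; case: i => [[|[|[|[|[|[|?]]]]]] ?].
have val_j i : val (j i) = nth 0%N [:: 2; 0; 1; 4; 5; 3]%N i.
  by rewrite permE; case: i => [[|[|[|[|[|[|?]]]]]] ?].
have val_s i : val (s i) = nth 0%N [:: 3; 4; 5; 0; 1; 2]%N i.
  by rewrite permE; case: i => [[|[|[|[|[|[|?]]]]]] ?].
pose o k (h : (k < 6)%N) := Ordinal h.
pose z := @o 0 isT; pose t := @o 3 isT.
(* An element of [W] is determined by its values at one point of each cycle. *)
have det (g : 'S_6) : g \in W -> val (g z) = val (w z) -> val (g t) = val (w t) -> w = g.
  move=> /cent1P gC /val_inj e0 /val_inj e3.
  have gc i : g (c i) = c (g i) by rewrite -!permM gC.
  have up i : w i = g i -> w (c i) = g (c i) by rewrite wc gc => ->.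
  have z0 := esym e0; have z1 := up _ z0; have z2 := up _ z1.
  have t0 := esym e3; have t1 := up _ t0; have t2 := up _ t1.
  apply/permP => i; have cz : [|| i == z, i == c z, i == c (c z), i == t, i == c t | i == c (c t)].
    by rewrite -!(inj_eq val_inj) !val_c; case: i => [[|[|[|[|[|[|?]]]]]] ?].
  by move: cz => /or4P[/eqP->|/eqP->|/eqP->|/or3P[] /eqP->].
have cW : c \in W by apply/cent1P.
have jW : j \in W by apply/cent1P; exact: commute_sym cj6C.
have sW : s \in W by apply/cent1P; exact: commute_sym cs6C.
have nwt : val (w t) \notin [:: val (w z); val (c (w z)); val (c (c (w z)))].
  by rewrite -!wc !inE !(inj_eq val_inj) !(inj_eq perm_inj) -!(inj_eq val_inj) !val_c.
have enc a b (e : bool) : (a < 3)%N -> (b < 3)%N ->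
    val ((c ^+ a * j ^+ b * s ^+ e) z) = ((if e then 3 else 0) + (a + 2 * b) %% 3)%N /\
    val ((c ^+ a * j ^+ b * s ^+ e) t) = ((if e then 0 else 3) + (a + b) %% 3)%N.
  case: a => [|[|[|?]]] //; case: b => [|[|[|?]]] //; case: e => _ _;
  by rewrite ?expgS ?expg0 !permM ?perm1 ?val_s ?val_j ?val_c.
pose x := val (w z); pose y := val (w t).
(* The solution modulo 3 of [a + 2 b = x], [a + b = y]; [e] records whether [w] exchanges the two
   cycles. *)
pose a := ((2 * (x + y)) %% 3)%N; pose b := ((x + 2 * y) %% 3)%N; pose e := (2 < x)%N.
have a3 : (a < 3)%N by rewrite ltn_pmod.
have b3 : (b < 3)%N by rewrite ltn_pmod.
have [ez et] := enc a b e a3 b3.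
exists a, b, e; split=> //; apply: det; first by rewrite !groupM ?groupX.
  rewrite ez -/x; move: nwt; rewrite !val_c /a /b /e -/x -/y /x /y.
  by case: (w z) => [[|[|[|[|[|[|?]]]]]] ?] //=; case: (w t) => [[|[|[|[|[|[|?]]]]]] ?].
rewrite et -/y; move: nwt; rewrite !val_c /a /b /e -/x -/y /x /y.
by case: (w z) => [[|[|[|[|[|[|?]]]]]] ?] //=; case: (w t) => [[|[|[|[|[|[|?]]]]]] ?].
Qed.

Lemma c6W : c \in W. Proof. exact/cent1P. Qed.
Lemma j6W : j \in W. Proof. by apply/cent1P; apply: commute_sym cj6C. Qed.
Lemma s6W : s \in W. Proof. by apply/cent1P; apply: commute_sym cs6C. Qed.

Definition word6 (a b : nat) (e : bool) : 'S_6 := c ^+ a * j ^+ b * s ^+ e.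

Lemma word6E a b e i :
  word6 a b e i = (if e then swap6 else 1) (iter b twist6 (iter a cyc6 i)).
Proof. by rewrite /word6 !permM !permX; case: e; rewrite ?perm1. Qed.

Lemma word6W a b e : word6 a b e \in W.
Proof. by rewrite !groupM ?groupX ?c6W ?j6W ?s6W. Qed.

Lemma j6_neq1 : j != 1.
Proof. by apply/eqP => /permP/(_ ord0)/(congr1 val); rewrite perm1 permE. Qed.
Lemma c6_neq1 : c != 1.
Proof. by apply/eqP => /permP/(_ ord0)/(congr1 val); rewrite perm1 permE. Qed.
Lemma s6_neq1 : s != 1.
Proof. by apply/eqP => /permP/(_ ord0)/(congr1 val); rewrite perm1 permE. Qed.

Lemma order_c6 : #[c] = 3.
Proof. exact: nt_prime_order c6X3 c6_neq1. Qed.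
Lemma order_j6 : #[j] = 3.
Proof. exact: nt_prime_order j6X3 j6_neq1. Qed.
Lemma order_s6 : #[s] = 2.
Proof. exact: nt_prime_order s6X2 s6_neq1. Qed.

Definition A6 : {group 'S_6} := (<[c]> <*> <[j]>)%G.
Definition B6 : {group 'S_6} := <[c * s]>%G.

Lemma A6E : A6 = <[c]> * <[j]> :> {set 'S_6}.
Proof. by rewrite /A6 /= cent_joinEl //; apply: cents_cycle; exact: cj6C. Qed.

Lemma c6A : c \in A6. Proof. by rewrite mem_gen // inE cycle_id. Qed.
Lemma j6A : j \in A6. Proof. by rewrite mem_gen // inE cycle_id orbT. Qed.

Lemma card_A6 : #|A6| = 9.
Proof.
rewrite A6E TI_cardMg -?orderE ?order_c6 ?order_j6 //; apply: prime_TIg.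
  by rewrite -orderE order_c6.
rewrite cycle_subG; apply/negP => /cycleP[i].
rewrite -(expg_mod i j6X3); have := ltn_pmod i (isT : (0 < 3)%N).
case: (i %% 3)%N => [|[|[|?]]] // _ /permP e.
- by move/(congr1 val): (e ord0); rewrite perm1 permE.
- by move/(congr1 val): (e ord0); rewrite expg1 !permE.
have i3 : (3 < 6)%N by [].
by move/(congr1 val): (e (Ordinal i3)); rewrite expgS expg1 permM !permE.
Qed.

Lemma WE : W = A6 * <[s]> :> {set 'S_6}.
Proof.
apply/eqP; rewrite eqEsubset; apply/andP; split.
  apply/subsetP => w /memW_enum[a [b [e [_ _ ->]]]].
  by rewrite mem_mulg ?mem_cycle // groupM ?groupX ?c6A ?j6A.
rewrite mul_subG // ?cycle_subG ?s6W // /A6 /= join_subG !cycle_subG c6W j6W //.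
Qed.

Lemma card_W : #|W| = 18.
Proof.
have sW : #|<[s]>| = 2 by rewrite -orderE order_s6.
by rewrite WE coprime_cardMg card_A6 sW.
Qed.

Lemma A6W : A6 \subset W.
Proof. by rewrite /A6 /= join_subG !cycle_subG c6W j6W. Qed.

Lemma isA_A6 : isA A6.
Proof.
split; last exact: card_A6.
by apply: p_index_maximal; rewrite ?A6W // -divgS ?A6W // card_W card_A6.
Qed.

Lemma order_cs : #[c * s] = 6.
Proof. by rewrite orderM ?order_c6 ?order_s6 //; exact: cs6C. Qed.

Lemma isB_B6 : isB B6.
Proof.
have sBW : B6 \subset W by rewrite cycle_subG groupM ?c6W ?s6W.
split; last exact: order_cs; last exact: cycle_cyclic.
apply: p_index_maximal => //; rewrite -divgS // card_W.
by rewrite -[#|B6|]/(#[c * s]) order_cs.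
Qed.

Lemma maxA_order3 (H : {group 'S_6}) : H \subset A6 -> #|H| = 3 -> maxA H.
Proof.
move=> sHA cH; exists A6; split; first exact: isA_A6.
by apply: p_index_maximal => //; rewrite -divgS // card_A6 cH.
Qed.

Lemma cycle_order3 (H : {group 'S_6}) x : x \in H -> x != 1 -> #|H| = 3 -> H :=: <[x]>.
Proof.
move=> Hx x1 cH; apply/esym/eqP; rewrite eqEcard cycle_subG Hx cH /=.
have : (#|<[x]>| %| #|H|)%N by rewrite cardSg // cycle_subG.
rewrite cH.
have : (1 < #|<[x]>|)%N by rewrite cardG_gt1 cycle_eq1.
by case: #|_| => [|[|[|?]]].
Qed.

Lemma isM_of (H : {group 'S_6}) : c \in H -> #|H| = 3 -> isM H.
Proof.
move=> Hc cH; have HE := cycle_order3 Hc c6_neq1 cH; split.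
  by apply: maxA_order3; rewrite // HE cycle_subG c6A.
exists B6; split; first exact: isB_B6.
rewrite HE cycle_subG; apply/cycleP; exists 4.
rewrite expgMn; last exact: cs6C.
by rewrite -(expg_mod 4 c6X3) -(expg_mod 4 s6X2) mulg1.
Qed.

Lemma cjC a b : commute (c ^+ a) (j ^+ b).
Proof. by apply: commuteX2; exact: cj6C. Qed.

Lemma cj_conj_s b : (c * j ^+ b) ^ s = c * (j ^+ b)^-1.
Proof.
rewrite conjMg conjXg js6 expgVn; congr (_ * _).
by rewrite conjgE cs6C mulKg.
Qed.

Lemma j_in_of (H : {group 'S_6}) b : (0 < b < 3)%N -> j ^+ b \in H -> j \in H.
Proof.
move=> hb Hb; have -> : j = (j ^+ b) ^+ b.
  by rewrite -expgM; case: b hb {Hb} => [|[|[|?]]] // _; rewrite -(expg_mod _ j6X3).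
exact: groupX.
Qed.

(** [H] has index 2 in [X], so an involution of [X] normalises it. That involution lies outside
    [A6], hence centralises [c] and inverts [j]; multiplying [c * j ^+ b] by its conjugate puts
    [c ^+ 2], then [c] and [j], in [H], which is too small. *)
Lemma isK_no_order6 (H X : {group 'S_6}) b : (0 < b < 3)%N -> c * j ^+ b \in H ->
  #|H| = 3 -> X \subset W -> #|X| = 6 -> H \subset X -> False.
Proof.
move=> hb Hh cH sXW cX sHX.
have nHX : H <| X by apply: index2_normal; rewrite // -divgS // cX cH.
have [|t Xt ot] := @Cauchy _ 2 X isT; first by rewrite cX.
have ht : (c * j ^+ b) ^ t \in H by rewrite memJ_norm // (subsetP (normal_norm nHX)).
have [a [b' [[] [_ _ Dt]]]] := memW_enum (subsetP sXW t Xt); last first.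
  have : t \in A6 by rewrite Dt mulg1 groupM ?groupX ?c6A ?j6A.
  by move/order_dvdG; rewrite ot card_A6.
have c1 : (c * j ^+ b) ^ (c ^+ a) = c * j ^+ b.
  have /commute_sym cc : commute (c ^+ a) (c * j ^+ b).
    by apply: commuteM; [apply/commute_sym/commuteX | exact: cjC].
  by rewrite conjgE cc mulKg.
have c2 : (c * j ^+ b) ^ (j ^+ b') = c * j ^+ b.
  have /commute_sym cc : commute (j ^+ b') (c * j ^+ b).
    by apply: commuteM; [exact/commute_sym/(cjC 1) | apply: commuteX2].
  by rewrite conjgE cc mulKg.
move: ht; rewrite Dt expg1 !conjgM c1 c2 cj_conj_s => ht.
have Hc2 : c ^+ 2 \in H.
  have -> : c ^+ 2 = (c * j ^+ b) * (c * (j ^+ b)^-1).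
    by rewrite mulgA -[c * j ^+ b * c]mulgA -(cjC 1 b) !mulgA mulgK.
  exact: groupM.
have Hc : c \in H.
  have -> : c = (c ^+ 2) ^+ 2 by rewrite -expgM -(expg_mod _ c6X3).
  exact: groupX.
have Hj : j \in H by apply: (j_in_of hb); rewrite -(groupMl _ Hc).
have : (#|A6| <= #|H|)%N by rewrite subset_leq_card // /A6 /= join_subG !cycle_subG Hc.
by rewrite card_A6 cH.
Qed.

Lemma cj_neq1 b : c * j ^+ b != 1.
Proof.
apply/eqP => e; have : (c * j ^+ b) ord0 = ord0 by rewrite e perm1.
have i3 : (3 < 6)%N by [].
have : (c * j ^+ b) (Ordinal i3) = Ordinal i3 by rewrite e perm1.
rewrite -(expg_mod b j6X3); have := ltn_pmod b (isT : (0 < 3)%N).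
by case: (b %% 3)%N => [|[|[|?]]] // _ /(congr1 val) + /(congr1 val);
  rewrite ?expgS ?expg0 !permM ?perm1 !permE.
Qed.

(** The groups generated by [c * j] and [c * j ^+ 2] are exchanged by conjugation by [s]. *)
Lemma isK_of (H : {group 'S_6}) b : (0 < b < 3)%N -> c * j ^+ b \in H -> #|H| = 3 -> isK H.
Proof.
move=> hb Hh cH; have HE := cycle_order3 Hh (cj_neq1 b) cH; split.
- by apply: maxA_order3; rewrite // HE cycle_subG groupM ?groupX ?c6A ?j6A.
- case=> B [[/maxgroupp/proper_sub sBW _ cB] sHB].
  exact: isK_no_order6 hb Hh cH sBW cB sHB.
case=> C [[/maxgroupp/proper_sub sCW _ cC] sHC].
exact: isK_no_order6 hb Hh cH sCW cC sHC.
Qed.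

Lemma card_sub_A6 (H : {group 'S_6}) : H \subset A6 -> H :!=: 1 -> H :=: A6 \/ #|H| = 3.
Proof.
move=> sHA H1; have : (#|H| %| 9)%N by rewrite -card_A6 cardSg.
have : (1 < #|H|)%N by rewrite cardG_gt1.
have : (#|H| <= 9)%N by rewrite -card_A6 subset_leq_card.
case eH: #|H| => [|[|[|[|[|[|[|[|[|[|?]]]]]]]]]] // _ _ _; first by right.
by left; apply/eqP; rewrite eqEcard sHA card_A6 eH.
Qed.

(** An element with [c]-exponent 1 excludes the trivial group and [J], generated by [j]; what
    remains is [A6] or the group of order 3 generated by that element. *)
Lemma subgroup_A (H : {group 'S_6}) :
  (forall w, w \in H -> exists a b, w = c ^+ a * j ^+ b) ->
  (exists b, c * j ^+ b \in H) -> [\/ isA H, isK H | isM H].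
Proof.
move=> sH [b]; rewrite -(expg_mod b j6X3); have := ltn_pmod b (isT : (0 < 3)%N).
move: (b %% 3)%N => {}b b3 Hb.
have sHA : H \subset A6.
  by apply/subsetP => w /sH[a [b' ->]]; rewrite groupM ?groupX ?c6A ?j6A.
have H1 : H :!=: 1.
  by apply: contraTneq Hb => ->; rewrite inE cj_neq1.
have [HA|cH] := card_sub_A6 sHA H1.
  by constructor 1; have -> : H = A6 by [apply: val_inj]; exact: isA_A6.
case: (posnP b) => b0; last by constructor 2; apply: (isK_of (b := b)) => //; rewrite b0.
by constructor 3; apply: isM_of => //; move: Hb; rewrite b0 mulg1.
Qed.

Lemma subgroup_M (H : {group 'S_6}) :
  (forall w, w \in H -> exists a, w = c ^+ a) -> c \in H -> isM H.
Proof.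
move=> sH Hc; apply: isM_of => //.
have -> : H :=: <[c]>; last by rewrite -orderE order_c6.
apply/eqP; rewrite eqEsubset cycle_subG Hc andbT.
by apply/subsetP => w /sH[a ->]; rewrite mem_cycle.
Qed.

Lemma subgroup_K (H : {group 'S_6}) b : (0 < b < 3)%N ->
  (forall w, w \in H -> exists a, w = c ^+ a * j ^+ (b * a)) -> c * j ^+ b \in H -> isK H.
Proof.
move=> hb sH Hh; apply: (isK_of hb) => //.
have HE : H :=: <[c * j ^+ b]>.
  apply/eqP; rewrite eqEsubset cycle_subG Hh andbT.
  apply/subsetP => w /sH[a ->]; rewrite expgM -expgMn ?mem_cycle //.
  exact: (cjC 1).
rewrite HE -orderE; apply: nt_prime_order (cj_neq1 b) => //.
rewrite expgMn; last exact: (cjC 1).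
by rewrite -expgM mulnC expgM c6X3 j6X3 expg1n mulg1.
Qed.

Lemma subgroup_B (H : {group 'S_6}) :
  (forall w, w \in H -> exists a e, w = c ^+ a * s ^+ e) ->
  (exists e, c * s ^+ e \in H) -> isB H \/ isM H.
Proof.
move=> sH [e He].
have csC : commute c (s ^+ e) by apply: commuteX; exact: cs6C.
have Hc : c \in H.
  (* 4 is 1 modulo 3 and 0 modulo 2, so this power keeps [c] and kills [s]. *)
  have <- : (c * s ^+ e) ^+ 4 = c; last exact: groupX.
  by rewrite (expgMn _ csC) -expgM mulnC expgM -(expg_mod 4 c6X3) -(expg_mod 4 s6X2) expg1n mulg1.
have cB : c \in B6.
  apply/cycleP; exists 4; rewrite (expgMn _ cs6C).
  by rewrite -(expg_mod 4 c6X3) -(expg_mod 4 s6X2) mulg1.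
have sB : s \in B6 by rewrite -(groupMl _ cB) cycle_id.
have sHB : H \subset B6.
  by apply/subsetP => w /sH[a [e' ->]]; rewrite groupM ?groupX.
have cB6 : #|B6| = 6 := order_cs.
have d6 : (#|H| %| 6)%N by have := cardSg sHB; rewrite cB6.
have d3 : (3 %| #|H|)%N by have := order_dvdG Hc; rewrite order_c6.
have [c3|c6] : #|H| = 3 \/ #|H| = 6.
  have le6 : (#|H| <= 6)%N by apply: dvdn_leq.
  by move: d6 d3 le6; case: #|H| => [|[|[|[|[|[|[|?]]]]]]] //; [left|right].
  by right; apply: isM_of.
left; have -> : H = B6; last exact: isB_B6.
by apply: val_inj; apply/eqP; rewrite eqEcard sHB c6 cB6.
Qed.

(** The condition on [b'] says that, modulo [c], the second element is neither trivial nor equal to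
    the involution [j ^+ b * s]; so the two generate [S_3] modulo [c]. Cubing the first element
    removes its power of [c]. *)
Lemma subgroup_W (H : {group 'S_6}) a b a' b' (e' : bool) b1 (e1 : bool) :
  H \subset W -> (b < 3)%N -> (b' < 3)%N ->
  c ^+ a * j ^+ b * s \in H ->
  c ^+ a' * j ^+ b' * s ^+ e' \in H -> (if e' then b' != b else b' != 0)%N ->
  c * j ^+ b1 * s ^+ e1 \in H -> isW H.
Proof.
move=> sHW b3 b'3 Ht Hg ne Hc1.
pose t := j ^+ b * s.
have jsj k : s * j ^+ k = (j ^+ k)^-1 * s.
  have := conjXg j s k; rewrite js6 expgVn => <-.
  have sV : s^-1 = s by apply: (mulgI s); rewrite mulgV -s6X2.
  by rewrite conjgE sV -!mulgA [s * s]s6X2 mulg1.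
have ct k : commute (c ^+ k) t.
  apply: commuteM; first exact: cjC.
  by apply/commute_sym/commuteX/commute_sym; exact: cs6C.
have tt : t * t = 1.
  by rewrite /t -mulgA (mulgA s) jsj -mulgA [s * s]s6X2 mulg1 mulgV.
have Htt : t \in H.
  have <- : (c ^+ a * j ^+ b * s) ^+ 3 = t; last exact: groupX.
  rewrite -mulgA -/t (expgMn _ (ct a)).
  by rewrite -expgM mulnC expgM c6X3 expg1n mul1g expgS expgS expg1 tt mulg1.
have [d d0 Hd] : exists2 d, (0 < d < 3)%N & c ^+ a' * j ^+ d \in H.
  case: e' ne Hg => [nb|b0] Hg; last first.
    by exists b'; rewrite ?lt0n ?b0 // -[_ * _]mulg1.
  (* Multiplying by [t] cancels [s] and leaves the exponent [b' - b] of [j]. *)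
  exists ((b' + 2 * b) %% 3)%N.
    rewrite ltn_pmod // andbT lt0n.
    by case: b b3 nb {Ht t ct tt Htt} => [|[|[|?]]] //; case: b' b'3 {Hg} => [|[|[|?]]].
  have <- : (c ^+ a' * j ^+ b' * s ^+ true) * t = c ^+ a' * j ^+ ((b' + 2 * b) %% 3); last exact: groupM.
  rewrite (expg_mod _ j6X3) expgD expgM /t expg1 -!mulgA; congr (_ * (_ * _)).
  rewrite mulgA jsj -mulgA [s * s]s6X2 mulg1; apply: (mulgI (j ^+ b)).
  have e3 : (b + 2 * b = 3 * b)%N by rewrite mulSn.
  by rewrite mulgV -expgM -expgD e3 expgM j6X3 expg1n.
(* [t] centralises [c] and inverts [j], so dividing the element by its conjugate leaves
   [j ^+ (2 * d)]. *)
have Hj : j \in H.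
  apply: (j_in_of d0).
  have Hdt : (c ^+ a' * j ^+ d) ^ t \in H by rewrite groupJ.
  have E : (c ^+ a' * j ^+ d) ^ t = c ^+ a' * (j ^+ d)^-1.
    rewrite conjMg; congr (_ * _); first by rewrite conjgE ct mulKg.
    rewrite /t conjgM [j ^+ d ^ _]conjgE (commuteX2 d b (commute_refl j)) mulKg.
    by rewrite conjXg js6 expgVn.
  move: (groupM (groupVr Hdt) Hd); rewrite E.
  rewrite invMg invgK -mulgA mulKg -expgD addnn -muln2 expgM => H2.
  have -> : j ^+ d = (j ^+ d ^+ 2) ^+ 2; last exact: groupX.
  rewrite -!expgM -(expg_mod _ j6X3) -[in RHS](expg_mod _ j6X3); congr (_ ^+ _).
  by case: d d0 {Hd Hdt E H2} => [|[|[|?]]].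
have Hs : s \in H by move: Htt; rewrite /t groupMl ?groupX.
have Hc : c \in H by move: Hc1; rewrite !groupMr ?groupX.
apply/eqP; rewrite eqEsubset sHW WE mul_subG ?cycle_subG //.
by rewrite /A6 /= join_subG !cycle_subG Hc.
Qed.

End SubgroupsOfW.

(** * The roots of [x^3 - 3 x + 1] and the permutations of 0, 1, oo *)

Section Anharmonic.
Variable K : numFieldType.
Implicit Types (x y l s t th : K).

(* The roots of [p3] are [z + z^-1] for the primitive 9th roots of unity [z]; [tau] permutes
   them cyclically, and [lam] lists them followed by their inverses. *)
Definition tau x := 1 - x^-1.

Definition lam th (i : 'I_6) : K :=
  nth 0 [:: th; tau th; tau (tau th); th^-1; (tau th)^-1; (tau (tau th))^-1] i.

Definition p3 x := x ^+ 3 - 3 * x + 1.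

Lemma p3_neq0 x : p3 x = 0 -> x != 0.
Proof.
by apply: contra_eqN => /eqP ->; rewrite /p3 expr0n mulr0 subr0 add0r oner_eq0.
Qed.

Lemma p3_neq1 x : p3 x = 0 -> x != 1.
Proof.
apply: contra_eqN => /eqP ->.
have -> : p3 1 = - 1 by rewrite /p3; ring.
by rewrite oppr_eq0 oner_eq0.
Qed.

Lemma p3_tau x : p3 x = 0 -> p3 (tau x) = 0.
Proof.
move=> px; have x0 := p3_neq0 px.
transitivity (- p3 x / x ^+ 3); first by rewrite /p3 /tau; field.
by rewrite px oppr0 mul0r.
Qed.

Lemma tau3 x : x != 0 -> x != 1 -> tau (tau (tau x)) = x.
Proof.
move=> x0 x1; have x1' : x - 1 != 0 by rewrite subr_eq0.
have e1 : tau x = (x - 1) / x by rewrite /tau; field.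
have -> : tau (tau x) = - (x - 1)^-1 by rewrite e1 /tau invf_div; field.
by rewrite /tau invrN invrK opprK addrC subrK.
Qed.

Lemma lam_tau th i : p3 th = 0 -> lam (tau th) i = lam th (cyc6 i).
Proof.
move=> pt; have t3 := tau3 (p3_neq0 pt) (p3_neq1 pt).
by rewrite permE; case: i => [[|[|[|[|[|[|?]]]]]] ?] //; rewrite /lam /= t3.
Qed.

Lemma lam_s6 th i : lam th (swap6 i) = (lam th i)^-1.
Proof. by rewrite permE; case: i => [[|[|[|[|[|[|?]]]]]] ?] //; rewrite /lam /= ?invrK. Qed.

Lemma tau_inv x y : x != 0 -> y != 0 -> y = tau x -> (1 - y)^-1 = x /\ (1 - x^-1)^-1 = y^-1.
Proof. by move=> x0 y0 ->; rewrite /tau opprB addrC subrK invrK. Qed.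

(** The map [x -> 1 / (1 - x)] is the inverse of [tau], so it runs backwards through the roots of
    [p3]; it sends [x^-1] to [(tau x)^-1], hence runs forwards through their inverses. *)
Lemma lam_j6 th i : p3 th = 0 -> lam th (twist6 i) = (1 - lam th i)^-1.
Proof.
move=> pt; have t3 := tau3 (p3_neq0 pt) (p3_neq1 pt).
have n0 := p3_neq0 pt; have n1 := p3_neq0 (p3_tau pt).
have n2 := p3_neq0 (p3_tau (p3_tau pt)).
have [a1 a2] := tau_inv n0 n1 erefl.
have [b1 b2] := tau_inv n1 n2 erefl.
have [d1 d2] := tau_inv n2 n0 (esym t3).
by rewrite permE; case: i => [[|[|[|[|[|[|?]]]]]] ?] //; rewrite /lam /= ?a1 ?a2 ?b1 ?b2 ?d1 ?d2.
Qed.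

(* The map [(x^2 - 2 x) / (1 - 2 x)] fixes [0], [1] and [oo] and is conjugate to [x^-2], whose
   3-periodic points are the primitive 9th roots of unity. *)
Definition rho x := (x ^+ 2 - 2 * x) / (1 - 2 * x).

(** [rho x - tau x] equals [p3 x / (x (1 - 2 x))], and [rho] commutes with inversion. *)
Lemma rho_root x : p3 x = 0 ->
  [/\ 1 - 2 * x != 0, rho x = tau x, 1 - 2 * x^-1 != 0 & rho x^-1 = (tau x)^-1].
Proof.
move=> px; have x0 := p3_neq0 px.
have n1 : 1 - 2 * x != 0.
  apply/negP => /eqP e; have : (8 * p3 x) = - 3 :> K.
    transitivity (- (1 - 2 * x) * (4 * x ^+ 2 + 2 * x - 11) - 3); first by rewrite /p3; ring.
    by rewrite e; ring.
  by rewrite px mulr0 => /eqP; rewrite eq_sym oppr_eq0 pnatr_eq0.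
have n2 : x - 2 != 0.
  apply/negP => /eqP e; have : p3 x = 3 :> K.
    transitivity ((x - 2) * (x ^+ 2 + 2 * x + 1) + 3); first by rewrite /p3; ring.
    by rewrite e; ring.
  by rewrite px => /eqP; rewrite eq_sym pnatr_eq0.
have e1 : rho x = tau x.
  apply/eqP; rewrite -subr_eq0; apply/eqP.
  transitivity (p3 x / (x * (1 - 2 * x))); first by rewrite /rho /tau /p3; field; rewrite x0 n1.
  by rewrite px mul0r.
split=> //.
  have -> : 1 - 2 * x^-1 = (x - 2) / x by field.
  by rewrite mulf_neq0 ?invr_eq0.
rewrite -e1 /rho invf_div; field.
by rewrite n2 x0 expr2 -mulrBl mulf_neq0.
Qed.

Lemma lam_rho th i : p3 th = 0 ->
  1 - 2 * lam th i != 0 /\ rho (lam th i) = lam th (cyc6 i).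
Proof.
move=> pt; have t3 := tau3 (p3_neq0 pt) (p3_neq1 pt).
have [a1 a2 a3 a4] := rho_root pt.
have [b1 b2 b3 b4] := rho_root (p3_tau pt).
have [d1 d2 d3 d4] := rho_root (p3_tau (p3_tau pt)).
rewrite t3 in d2 d4.
by rewrite permE; case: i => [[|[|[|[|[|[|?]]]]]] ?] //; rewrite /lam /=.
Qed.

Lemma tau_neq x : p3 x = 0 -> tau x != x.
Proof.
move=> px; have x0 := p3_neq0 px; apply/negP => /eqP e.
have e2 : x ^+ 2 - x + 1 = 0.
  transitivity (x * (x - tau x)); first by rewrite /tau; field.
  by rewrite e subrr mulr0.
have : 3 * x = 0.
  transitivity ((x + 1) * (x ^+ 2 - x + 1) - p3 x); first by rewrite /p3; ring.
  by rewrite e2 px; ring.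
by move/eqP; rewrite mulf_eq0 pnatr_eq0 /= (negPf x0).
Qed.

(** [p3] and its reciprocal polynomial differ by [3 y (y - 1)], and neither 0 nor 1 is a root of
    [p3]. *)
Lemma p3_inv_neq x y : p3 x = 0 -> p3 y = 0 -> x != y^-1.
Proof.
move=> px py; have y0 := p3_neq0 py; apply/negP => /eqP e.
have : 3 * (y ^+ 2 - y) = 0.
  transitivity (p3 y - y ^+ 3 * p3 y^-1); first by rewrite /p3; field.
  by rewrite -e px py; ring.
have -> : 3 * (y ^+ 2 - y) = 3 * y * (y - 1) by ring.
by move/eqP; rewrite !mulf_eq0 pnatr_eq0 /= (negPf y0) subr_eq0 (negPf (p3_neq1 py)).
Qed.

Lemma lam_inj th : p3 th = 0 -> injective (lam th).
Proof.
move=> p0; have p1 := p3_tau p0; have p2 := p3_tau p1.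
have t3 := tau3 (p3_neq0 p0) (p3_neq1 p0).
have n01 : th != tau th by rewrite eq_sym tau_neq.
have n12 : tau th != tau (tau th) by rewrite eq_sym tau_neq.
have n02 : th != tau (tau th) by rewrite -{1}t3 tau_neq.
move=> i i' /eqP; rewrite /lam nth_uniq ?ltn_ord //; first by move/eqP/val_inj.
by rewrite /= !inE !negb_or !(inj_eq invr_inj) n01 n12 n02 !p3_inv_neq.
Qed.

(** On [x = z + z^-1] this exhibits [tau] as the squaring of [z]. *)
Lemma tau_poly x : p3 x = 0 -> tau x = x ^+ 2 - 2 /\ tau (tau x) = 2 - x - x ^+ 2.
Proof.
move=> px; have x0 := p3_neq0 px; have x1 := p3_neq0 (p3_tau px).
have e1 : tau x = x ^+ 2 - 2.
  apply/eqP; rewrite -subr_eq0; apply/eqP.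
  transitivity (- p3 x / x); first by rewrite /tau /p3; field.
  by rewrite px oppr0 mul0r.
split=> //; rewrite {1}/tau; apply: (mulfI x1); rewrite mulrBr mulfV // mulr1 e1.
apply/eqP; rewrite -subr_eq0; apply/eqP.
transitivity ((x + 1) * p3 x); first by rewrite /p3; ring.
by rewrite px mulr0.
Qed.

Lemma p3_factor th l : p3 th = 0 -> p3 l = (l - th) * (l - tau th) * (l - tau (tau th)).
Proof.
move=> pt; have [-> ->] := tau_poly pt.
apply/eqP; rewrite -subr_eq0; apply/eqP.
transitivity (((th + 1) * l - th ^+ 2 - th + 1) * p3 th); first by rewrite /p3; ring.
by rewrite pt mulr0.
Qed.

Lemma p3_rootsP th l : p3 th = 0 -> p3 l = 0 -> [\/ l = th, l = tau th | l = tau (tau th)].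
Proof.
move=> pt; rewrite (p3_factor _ pt) => /eqP; rewrite !mulf_eq0 !subr_eq0 -orbA.
by case/or3P => /eqP; [constructor 1|constructor 2|constructor 3].
Qed.

Lemma lam_surj th s t : p3 th = 0 -> nz s t ->
  s ^+ 3 - 3 * s * t ^+ 2 + t ^+ 3 = 0 \/ s ^+ 3 - 3 * s ^+ 2 * t + t ^+ 3 = 0 ->
  t != 0 /\ exists i, s / t = lam th i.
Proof.
move=> pt n h.
have t0 : t != 0.
  apply/negP => /eqP t0; move: n; rewrite /nz t0 eqxx orbF => s0.
  have : s ^+ 3 = 0 by case: h => <-; rewrite t0; ring.
  by move/eqP; rewrite expf_eq0 (negPf s0).
have s0 : s != 0.
  apply/negP => /eqP s0; have : t ^+ 3 = 0 by case: h => <-; rewrite s0; ring.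
  by move/eqP; rewrite expf_eq0 (negPf t0).
split=> //.
have mk (k : nat) : (k < 6)%N -> forall x, x = nth 0 [:: th; tau th; tau (tau th); th^-1; (tau th)^-1; (tau (tau th))^-1] k ->
    exists i, x = lam th i.
  by move=> hk x e; exists (Ordinal hk).
case: h => e.
  have : p3 (s / t) = 0.
    transitivity ((s ^+ 3 - 3 * s * t ^+ 2 + t ^+ 3) / t ^+ 3); first by rewrite /p3; field.
    by rewrite e mul0r.
  by case/(p3_rootsP pt) => ->; [apply: (mk 0%N)|apply: (mk 1%N)|apply: (mk 2%N)].
have : p3 (t / s) = 0.
  transitivity ((s ^+ 3 - 3 * s ^+ 2 * t + t ^+ 3) / s ^+ 3); first by rewrite /p3; field.
  by rewrite e mul0r.
rewrite -[s / t]invf_div.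
by case/(p3_rootsP pt) => ->; [apply: (mk 3%N)|apply: (mk 4%N)|apply: (mk 5%N)].
Qed.

(* [Mob] sends [0], [1], [oo] to [y1^-1], [y2^-1], [y3^-1], the fixed points of [psi v] when the
   [y_i] are the roots of [y^3 - 3 y^2 + v]. *)
Definition Mob (y1 y2 y3 s t : K) :=
  pt (s * (y1 - y2) + t * (y2 - y3)) (s * ((y1 - y2) * y3) + t * ((y2 - y3) * y1)).

Definition lab y1 y2 y3 th i := Mob y1 y2 y3 (lam th i) 1.

Lemma lab_tau y1 y2 y3 th i : p3 th = 0 ->
  lab y1 y2 y3 (tau th) i = lab y1 y2 y3 th (cyc6 i).
Proof. by move=> pt; rewrite /lab lam_tau. Qed.

Lemma lam_neq0 th i : p3 th = 0 -> lam th i != 0.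
Proof.
move=> p0; have p1 := p3_tau p0; have p2 := p3_tau p1.
by case: i => [[|[|[|[|[|[|?]]]]]] ?] //; rewrite /lam /= ?invr_eq0 p3_neq0.
Qed.

Lemma lam_neq1 th i : p3 th = 0 -> lam th i != 1.
Proof.
move=> p0; have p1 := p3_tau p0; have p2 := p3_tau p1.
by case: i => [[|[|[|[|[|[|?]]]]]] ?] //; rewrite /lam /= ?invr_eq1 p3_neq1.
Qed.

(** Renaming the [y_i] cyclically amounts to composing [Mob] with [x -> 1 / (1 - x)], which rotates
    0, 1, oo. In [lab_rev] the map is [x -> 1 / x]. *)
Lemma lab_rot y1 y2 y3 th i : p3 th = 0 ->
  lab y2 y3 y1 th i = lab y1 y2 y3 th (twist6 i).
Proof.
move=> p0; rewrite /lab lam_j6 //; move: (lam_neq1 i p0); move: (lam th i) => l l1.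
have l1' : 1 - l != 0 by rewrite subr_eq0 eq_sym.
rewrite /Mob -(@ptM _ (l - 1) ((1 - l)^-1 * (y1 - y2) + _)) ?subr_eq0 //.
by congr pt; field.
Qed.

Lemma lab_rev y1 y2 y3 th i : p3 th = 0 ->
  lab y3 y2 y1 th i = lab y1 y2 y3 th (swap6 i).
Proof.
move=> p0; rewrite /lab lam_s6 //; move: (lam_neq0 i p0); move: (lam th i) => l l0.
rewrite /Mob -(@ptM _ (- l) (l^-1 * (y1 - y2) + _)) ?oppr_eq0 //.
by congr pt; field.
Qed.

End Anharmonic.

(** * Permutations of the triple of roots *)

Section Triples.
Variable K : numFieldType.
Implicit Types (Y : K * K * K) (th : K).

Definition rot3 Y : K * K * K := (Y.1.2, Y.2, Y.1.1).
Definition rev3 Y : K * K * K := (Y.2, Y.1.2, Y.1.1).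
(** With [b < 3] these are all the permutations of a triple, and [e] is the parity. *)
Definition sym3 (b : nat) (e : bool) Y := iter b rot3 (if e then rev3 Y else Y).
Definition lab3 Y := lab Y.1.1 Y.1.2 Y.2.

Lemma p3_iter th a : p3 th = 0 -> p3 (iter a (@tau K) th) = 0.
Proof. by move=> pt; elim: a => //= a /p3_tau. Qed.

Lemma lab3_act Y th a b e i : p3 th = 0 ->
  lab3 (sym3 b e Y) (iter a (@tau K) th) i =
  lab3 Y th (word6 a b e i).
Proof.
move=> pt; rewrite word6E; transitivity (lab3 (sym3 b e Y) th (iter a cyc6 i)).
  elim: a i => [//|a IH] i; rewrite [in RHS]iterSr -IH [in LHS]iterS.
  by rewrite /lab3 lab_tau ?p3_iter.
move: (iter a _ i) => {}i; rewrite /sym3.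
transitivity (lab3 (if e then rev3 Y else Y) th (iter b twist6 i)).
  elim: b i => [//|b IH] i; rewrite [in RHS]iterSr -IH [in LHS]iterS.
  exact: lab_rot.
by case: e => /=; [exact: (lab_rev Y.1.1 Y.1.2 Y.2 _ pt) | rewrite perm1].
Qed.

(** The left sides are [F_Z] and [- F_X] for [F] the product of the [Z - y_i X]. In the coordinate
    [s / t] this map is [rho], whatever the [y_i]. *)
Lemma Mob_cubic (y1 y2 y3 s t : K) :
  let D := (y1 - y2) * (y2 - y3) * (y1 - y3) in
  let X := s * (y1 - y2) + t * (y2 - y3) in
  let Z := s * ((y1 - y2) * y3) + t * ((y2 - y3) * y1) in
  let s' := s ^+ 2 - 2 * s * t in let t' := t ^+ 2 - 2 * s * t in
  let e1 := y1 + y2 + y3 in let e2 := y1 * y2 + y1 * y3 + y2 * y3 in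
  3 * Z ^+ 2 - 2 * e1 * X * Z + e2 * X ^+ 2 = D * (s' * (y1 - y2) + t' * (y2 - y3)) /\
  e1 * Z ^+ 2 - 2 * e2 * X * Z + 3 * (y1 * y2 * y3) * X ^+ 2 =
    D * (s' * ((y1 - y2) * y3) + t' * ((y2 - y3) * y1)).
Proof. by split; rewrite /=; ring. Qed.

(** A double root of [y^3 - 3 y^2 + V] is a zero of [3 y (y - 2)], which gives [V = 0] or
    [V = 4]. *)
Lemma sym_neq (V a b c : K) : a + b + c = 3 -> a * b + a * c + b * c = 0 ->
  a * b * c = - V -> V != 0 -> V != 4 -> a != b.
Proof.
move=> e1 e2 e3 V0 V4; apply/negP => /eqP ab; rewrite -{b}ab in e1 e2 e3.
have c3 : c = 3 - 2 * a by rewrite -e1; ring.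
have : 3 * a * (2 - a) = 0 by rewrite -e2 c3; ring.
move/eqP; rewrite !mulf_eq0 pnatr_eq0 /= subr_eq0 => /orP[|] /eqP a0.
  by move/eqP: V0; apply; rewrite -[V]opprK -e3 a0; ring.
by move/eqP: V4; apply; rewrite -[V]opprK -e3 c3 -a0; ring.
Qed.

End Triples.

(** * The 3-periodic points of [psi v] and the Galois action on them *)

Section PeriodThree.
Variables (v : rat) (y1 y2 y3 th : algC).
Hypotheses (v0 : v != 0) (v4 : v != 4).
Hypothesis e1 : y1 + y2 + y3 = 3.
Hypothesis e2 : y1 * y2 + y1 * y3 + y2 * y3 = 0.
Hypothesis e3 : y1 * y2 * y3 = - ratr v.
Hypothesis pth : p3 th = 0.

Let V0 : (ratr v : algC) != 0. Proof. by rewrite fmorph_eq0. Qed.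
Let V4 : (ratr v : algC) != 4.
Proof. by rewrite -(rmorph_nat (ratr : rat -> algC) 4) fmorph_eq. Qed.

Lemma y12 : y1 != y2. Proof. exact: sym_neq e1 e2 e3 V0 V4. Qed.
Lemma y23 : y2 != y3.
Proof.
apply: (@sym_neq _ (ratr v) y2 y3 y1) => //.
- by rewrite -e1; ring.
- by rewrite -e2; ring.
- by rewrite -e3; ring.
Qed.
Lemma y13 : y1 != y3.
Proof.
apply: (@sym_neq _ (ratr v) y1 y3 y2) => //.
- by rewrite -e1; ring.
- by rewrite -e2; ring.
- by rewrite -e3; ring.
Qed.

Let D := (y1 - y2) * (y2 - y3) * (y1 - y3).
Let D0 : D != 0. Proof. by rewrite !mulf_neq0 // subr_eq0 ?y12 ?y23 ?y13. Qed.
Let det : (y1 - y2) * ((y2 - y3) * y1) - (y1 - y2) * y3 * (y2 - y3) != 0.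
Proof. by apply: contraNneq D0 => <-; rewrite /D; apply/eqP; ring. Qed.

Local Notation M := (Mob y1 y2 y3).
Local Notation l := (lab y1 y2 y3 th).

Lemma Mob_eq s t s' t' : nz s t -> nz s' t' -> M s t = M s' t' <-> s * t' = s' * t.
Proof. by have [/= UE _] := pt_basis det; apply: UE. Qed.

Lemma Mob_surj P : exists s t, nz s t /\ P = M s t.
Proof. by have [/= _ US] := pt_basis det; apply: US. Qed.

Lemma dyn_Mob s t : nz s t ->
  dyn (psi v) (M s t) = M (s ^+ 2 - 2 * s * t) (t ^+ 2 - 2 * s * t) /\
  nz (s ^+ 2 - 2 * s * t) (t ^+ 2 - 2 * s * t).
Proof.
move=> n; have nM := nz_lin det n.
have [E1 E2] := Mob_cubic y1 y2 y3 s t.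
split.
  rewrite /Mob; have [-> _] := dyn_psi_pt v0 v4 nM.
  (* For [e1 = 3] and [e2 = 0] the forms of [Mob_cubic] are [- 3] times those of [psi v]. *)
  have k3 : (- 3 : algC) != 0 by rewrite oppr_eq0 pnatr_eq0.
  rewrite -[LHS](ptM _ _ k3) -[RHS](ptM _ _ D0) -E1 -E2 e1 e2 e3.
  by congr pt; ring.
move: n; rewrite /nz -!negb_and; apply: contra => /andP[/eqP h1 /eqP h2].
have s3 : 3 * s ^+ 3 = 0.
  transitivity (3 * s * (s ^+ 2 - 2 * s * t) -
     2 * (t * (s ^+ 2 - 2 * s * t) + 2 * s * (t ^+ 2 - 2 * s * t))); first by ring.
  by rewrite h1 h2; ring.
have t3 : 3 * t ^+ 3 = 0.
  transitivity (3 * t * (t ^+ 2 - 2 * s * t) -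
     2 * (s * (t ^+ 2 - 2 * s * t) + 2 * t * (s ^+ 2 - 2 * s * t))); first by ring.
  by rewrite h1 h2; ring.
move/eqP: s3; rewrite mulf_eq0 pnatr_eq0 expf_eq0 /= => ->.
by move/eqP: t3; rewrite mulf_eq0 pnatr_eq0 expf_eq0 /=.
Qed.

Lemma lab_dyn i : dyn (psi v) (l i) = l (cyc6 i).
Proof.
have n1 (x : algC) : nz x 1 by rewrite /nz oner_eq0 orbT.
have [n2 rE] := lam_rho i pth.
have [-> n] := dyn_Mob (n1 (lam th i)); rewrite /lab Mob_eq // -rE /rho.
by move: n2; rewrite !mulr1 expr1n => n2; rewrite mulfVK.
Qed.

Lemma lab_inj : injective l.
Proof.
have n1 (x : algC) : nz x 1 by rewrite /nz oner_eq0 orbT.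
by move=> i k /Mob_eq - /(_ (n1 _) (n1 _)); rewrite !mulr1 => /(lam_inj pth).
Qed.

Lemma lab_iter n i : iter n (dyn (psi v)) (l i) = l ((cyc6 ^+ n)%g i).
Proof. by elim: n => [|n IH] /=; rewrite ?perm1 // IH lab_dyn -permM -expgSr. Qed.

Lemma psi_labels : labels3 (psi v) l.
Proof.
split; [exact: lab_inj | | exact: lab_dyn].
move=> P; split; last first.
  case=> i <-; split=> //; rewrite lab_iter c6X3 perm1; split=> // m hm.
  rewrite lab_iter => /lab_inj; case: m hm => [|[|[|?]]] // _;
  by rewrite ?expgS ?expg0 ?permM ?mulg1 !permE => /(congr1 val);
    case: i => [[|[|[|[|[|[|?]]]]]] ?].
case=> _ [e3P e1P].
have [s [t [n DP]]] := Mob_surj P.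
have {}e1P : M (s ^+ 2 - 2 * s * t) (t ^+ 2 - 2 * s * t) <> M s t.
  by have [<- _] := dyn_Mob n; rewrite -DP; apply: (e1P 1%N).
have [d1 n1] := dyn_Mob n; have [d2 n2] := dyn_Mob n1; have [d3 n3] := dyn_Mob n2.
move: e3P; rewrite /= DP d1 d2 d3 Mob_eq // => /eqP; rewrite -subr_eq0.
have -> : forall x y : algC, (x - y == 0) = (y - x == 0) by move=> x y; rewrite -opprB oppr_eq0.
set LHS := (X in X == 0).
(* The nine fixed points of the third iterate of [rho]: the fixed points 0, 1, oo, the roots of
   [p3], and their inverses. *)
have -> : LHS = - 9 * (s * t * (s - t)) * (s ^+ 3 - 3 * s * t ^+ 2 + t ^+ 3) *
    (s ^+ 3 - 3 * s ^+ 2 * t + t ^+ 3) by rewrite /LHS; ring.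
rewrite mulf_eq0 mulf_eq0 mulf_eq0 oppr_eq0 pnatr_eq0 /= => /orP[/orP[fix0|pz]|qz].
- case: e1P; rewrite Mob_eq //; apply/eqP; rewrite -subr_eq0.
  move: fix0; set E := (X in X == 0); set G := (X in _ -> X == 0).
  have -> : G = 3 * E by rewrite /G /E; ring.
  by move/eqP ->; rewrite mulr0.
- have [t0 [i Di]] := lam_surj pth n (or_introl (eqP pz)).
  exists i; rewrite /lab Mob_eq // -?Di ?mulr1 ?divfK //.
  by rewrite /nz oner_eq0 orbT.
- have [t0 [i Di]] := lam_surj pth n (or_intror (eqP qz)).
  exists i; rewrite /lab Mob_eq // -?Di ?mulr1 ?divfK //.
  by rewrite /nz oner_eq0 orbT.
Qed.

Lemma aut_roots (nu : {rmorphism algC -> algC}) : exists a b (e : bool),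
  [/\ (a < 3)%N, (b < 3)%N, nu th = iter a (@tau algC) th
    & (nu y1, nu y2, nu y3) = sym3 b e (y1, y2, y3)].
Proof.
have [a a3 Da] : exists2 a, (a < 3)%N & nu th = iter a (@tau algC) th.
  have : p3 (nu th) = 0.
    by rewrite -[RHS](rmorph0 nu) -pth /p3 !(rmorphD, rmorphN, rmorphM, rmorphXn, rmorph1).
  by case/(p3_rootsP pth) => ->; [exists 0%N|exists 1%N|exists 2%N].
have root (y : algC) : y \in [:: y1; y2; y3] -> nu y \in [:: y1; y2; y3].
  have fac (x : algC) : x ^+ 3 - 3 * x ^+ 2 + ratr v = (x - y1) * (x - y2) * (x - y3).
    have -> : (ratr v : algC) = - (y1 * y2 * y3) by rewrite e3 opprK.
    rewrite -e1; apply/eqP; rewrite -subr_eq0; apply/eqP.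
    transitivity (- (y1 * y2 + y1 * y3 + y2 * y3) * x); first by ring.
    by rewrite e2 oppr0 mul0r.
  have mem (x : algC) : (x \in [:: y1; y2; y3]) = (x ^+ 3 - 3 * x ^+ 2 + ratr v == 0).
    by rewrite fac !mulf_eq0 !subr_eq0 !inE -orbA.
  rewrite !mem => /eqP y0; apply/eqP; rewrite -[RHS](rmorph0 nu) -y0.
  by rewrite [RHS]rmorphD fmorph_rat !(rmorphD, rmorphN, rmorphM, rmorphXn, rmorph1).
have n12 : nu y1 != nu y2 by rewrite fmorph_eq y12.
have n13 : nu y1 != nu y3 by rewrite fmorph_eq y13.
have n23 : nu y2 != nu y3 by rewrite fmorph_eq y23.
have := root y1; have := root y2; have := root y3; rewrite !inE !eqxx ?orbT.
move=> /(_ isT)/or3P r3 /(_ isT)/or3P r2 /(_ isT)/or3P r1.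
exists a.
suff [b [e [b3 Db]]] : exists b (e : bool), (b < 3)%N /\ (nu y1, nu y2, nu y3) = sym3 b e (y1, y2, y3).
  by exists b, e.
case: r1 => /eqP E1; case: r2 => /eqP E2; case: r3 => /eqP E3;
  rewrite ?E1 ?E2 ?E3 ?eqxx // in n12 n13 n23 *.
- by exists 0%N, false.
- by exists 2%N, true.
- by exists 1%N, true.
- by exists 1%N, false.
- by exists 2%N, false.
- by exists 0%N, true.
Qed.

Lemma aut_lab (nu : {rmorphism algC -> algC}) a b e :
  nu th = iter a (@tau algC) th -> (nu y1, nu y2, nu y3) = sym3 b e (y1, y2, y3) ->
  forall i, omap nu (l i) = l (word6 a b e i).
Proof.
move=> Da Db i; have := lab3_act (y1, y2, y3) a b e i pth.
rewrite {2}/lab3 /= => <-; rewrite -Da -Db /lab3 /= /lab /Mob.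
have nu_pt (x y : algC) : omap nu (pt x y) = pt (nu x) (nu y).
  by rewrite /pt fmorph_eq0; case: ifP => //= _; rewrite fmorph_div.
have nu_tau (x : algC) : nu (tau x) = tau (nu x) by rewrite /tau rmorphB rmorph1 fmorphV.
have nu_lam : nu (lam th i) = lam (nu th) i.
  by case: i => [[|[|[|[|[|[|?]]]]]] ?] //; rewrite /lam /= ?fmorphV ?nu_tau.
by rewrite nu_pt !(rmorphD, rmorphN, rmorphM) nu_lam !rmorph1.
Qed.

(** [H] is the image of Galois, seen through the actions on [th] and on the [y_i] alone, so that the
    case analysis never returns to the periodic points. *)
Definition gal_spec (H : {group 'S_6}) : Prop :=
  (forall nu : {rmorphism algC -> algC}, exists a b (e : bool),
    [/\ (a < 3)%N, (b < 3)%N, nu th = iter a (@tau algC) th,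
        (nu y1, nu y2, nu y3) = sym3 b e (y1, y2, y3)
      & word6 a b e \in H]) /\
  (forall w, w \in H -> exists (nu : {rmorphism algC -> algC}) a b (e : bool),
    [/\ (a < 3)%N, (b < 3)%N, nu th = iter a (@tau algC) th,
        (nu y1, nu y2, nu y3) = sym3 b e (y1, y2, y3)
      & w = word6 a b e]).

Lemma gal_group (X : {group 'S_6} -> Prop) :
  (forall H, gal_spec H -> X H) -> G3bar_is (psi v) X.
Proof.
pose P (w : 'S_6) := exists nu : {rmorphism algC -> algC}, forall i, omap nu (l i) = l (w i).
(* A finite set needs a boolean predicate, and [P] quantifies over field automorphisms. *)
pose H := [set w | if excluded_middle_informative (P w) then true else false].
have HP w : w \in H <-> P w by rewrite inE; case: excluded_middle_informative.
have gH : group_set H.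
  apply/group_setP; split=> [|w1 w2 /HP[nu1 E1] /HP[nu2 E2]]; apply/HP.
    by exists idfun => i; rewrite perm1; case: (l i).
  (* Products of permutations are read from left to right, so [w1 * w2] comes from [nu2] after
     [nu1]. *)
  exists (nu2 \o nu1) => i; rewrite permM -E2 -E1.
  by case: (l i).
move=> XH; exists l; split; first exact: psi_labels.
have act (nu : {rmorphism algC -> algC}) : exists a b (e : bool), [/\ (a < 3)%N, (b < 3)%N, nu th = iter a (@tau algC) th,
        (nu y1, nu y2, nu y3) = sym3 b e (y1, y2, y3) &
        forall i, omap nu (l i) = l (word6 a b e i)].
  have [a [b [e [a3 b3 Da Db]]]] := aut_roots nu.
  by exists a, b, e; split=> //; apply: aut_lab.
exists (Group gH); split; last first.
  split=> [nu|w /HP //]; have [a [b [e [_ _ _ _ E]]]] := act nu.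
  by eexists; last exact: E; apply/HP; exists nu.
apply: XH; split=> [nu|w /HP[nu E]].
  have [a [b [e [a3 b3 Da Db E]]]] := act nu.
  by exists a, b, e; split=> //; apply/HP; exists nu.
have [a [b [e [a3 b3 Da Db E']]]] := act nu.
exists nu, a, b, e; split=> //; apply/permP => i; apply: lab_inj.
by rewrite -E E'.
Qed.

End PeriodThree.

(** * Existence of the roots, and the discriminant *)

(** [th] is [z + z^-1] for a primitive 9th root of unity [z], and [nu] is a cyclotomic automorphism
    with [z -> z^2]. *)
Lemma exists_theta : exists (th : algC) (nu : {rmorphism algC -> algC}),
  p3 th = 0 /\ nu th = tau th.
Proof.
have [z pz] := C_prim_root_exists (isT : (0 < 9)%N).
have z9 : z ^+ 9 = 1 := prim_expr_order pz.
have z0 : z != 0.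
  by apply: contraTneq (oner_neq0 algC) => e; rewrite -z9 e expr0n /= eqxx.
have z3 : z ^+ 3 != 1 by rewrite -(prim_order_dvd pz).
have p0 : p3 (z + z^-1) = 0.
  have n3 : z ^+ 3 - 1 != 0 by rewrite subr_eq0.
  apply: (mulfI n3); rewrite mulr0.
  transitivity ((z ^+ 9 - 1) / z ^+ 3); first by rewrite /p3; field.
  by rewrite z9 subrr mul0r.
have [nu Dnu] := Qn_aut_exists (isT : coprime 2 9).
exists (z + z^-1), nu; split=> //; have [-> _] := tau_poly p0.
by rewrite rmorphD fmorphV Dnu //; field.
Qed.

Lemma cubic_roots (v : rat) : exists y1 y2 y3 : algC,
  [/\ y1 + y2 + y3 = 3, y1 * y2 + y1 * y3 + y2 * y3 = 0 & y1 * y2 * y3 = - ratr v].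
Proof.
pose p : {poly algC} := Poly [:: ratr v; 0; - 3; 1].
have pE x : p.[x] = x ^+ 3 - 3 * x ^+ 2 + ratr v by rewrite horner_Poly /=; ring.
have sp : size p = 4%N by rewrite (@PolyK _ 0) //= oner_eq0.
have lp : lead_coef p = 1 by rewrite /lead_coef sp /= (@PolyK _ 0) //= oner_eq0.
have [r Dr] := closed_field_poly_normal p; rewrite lp scale1r in Dr.
have : size r = 3%N by move: sp; rewrite Dr size_prod_XsubC => -[].
case: r Dr => [|y1 [|y2 [|y3 []]]] // Dr _; exists y1, y2, y3.
have E x : x ^+ 3 - 3 * x ^+ 2 + ratr v = (x - y1) * (x - y2) * (x - y3).
  by rewrite -pE Dr !big_cons big_nil mulr1 !hornerM !hornerXsubC mulrA.
(* Three values of the monic cubic determine its three lower coefficients, hence the symmetric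
   functions. *)
have E0 := E 0; have E1 := E 1; have E2 := E (-1).
have two0 : (2 : algC) != 0 by rewrite pnatr_eq0.
have e3 : y1 * y2 * y3 = - ratr v.
  transitivity (- ((0 - y1) * (0 - y2) * (0 - y3))); first by ring.
  by rewrite -E0; ring.
split=> //; apply: (mulfI two0).
  transitivity (- ((1 - y1) * (1 - y2) * (1 - y3) + (- 1 - y1) * (- 1 - y2) * (- 1 - y3)
    + 2 * (y1 * y2 * y3))); first by ring.
  by rewrite -E1 -E2 e3; ring.
transitivity ((1 - y1) * (1 - y2) * (1 - y3) - (- 1 - y1) * (- 1 - y2) * (- 1 - y3) - 2);
  first by ring.
by rewrite -E1 -E2; ring.
Qed.

Definition disc3 (K : numFieldType) (Y : K * K * K) :=
  (Y.1.1 - Y.1.2) * (Y.1.2 - Y.2) * (Y.1.1 - Y.2).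

Lemma disc_sym3 (K : numFieldType) b e (Y : K * K * K) :
  disc3 (sym3 b e Y) = if e then - disc3 Y else disc3 Y.
Proof.
rewrite /sym3; elim: b => [|b <-] /=; last by rewrite /disc3 /=; ring.
by case: e => //; rewrite /disc3 /=; ring.
Qed.

Lemma disc_sq (K : numFieldType) (V y1 y2 y3 : K) :
  y1 + y2 + y3 = 3 -> y1 * y2 + y1 * y3 + y2 * y3 = 0 -> y1 * y2 * y3 = - V ->
  disc3 (y1, y2, y3) ^+ 2 = 27 * V * (4 - V).
Proof.
move=> e1 e2 e3.
transitivity ((y1 + y2 + y3) ^+ 2 * (y1 * y2 + y1 * y3 + y2 * y3) ^+ 2
  - 4 * (y1 * y2 + y1 * y3 + y2 * y3) ^+ 3 - 4 * (y1 + y2 + y3) ^+ 3 * (y1 * y2 * y3)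
  - 27 * (y1 * y2 * y3) ^+ 2
  + 18 * (y1 + y2 + y3) * (y1 * y2 + y1 * y3 + y2 * y3) * (y1 * y2 * y3)).
  by rewrite /disc3 /=; ring.
by rewrite e1 e2 e3; ring.
Qed.

(** With [r = w / (3 v)] the equation becomes [v = 12 / (r^2 + 3)], and this is [alpha u] for
    [r = 3 (1 - u) / (1 + u)]. *)
Lemma ImAlpha_sq v w : v != 0 -> w ^+ 2 = 27 * v * (4 - v) -> ImAlpha v.
Proof.
move=> v0 w2; pose r := w / (3 * v).
have r2 : v * (r ^+ 2 + 3) = 12.
  transitivity (w ^+ 2 / (9 * v) + 3 * v); first by rewrite /r; field.
  by rewrite w2; field.
(* [r = - 3] corresponds to [u = oo]; there [v = 1], a value also taken at [u = 0]. *)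
have [r3|r3] := eqVneq (3 + r) 0.
  exists 0; split; first by [].
  have r3' : r = - 3 by apply/eqP; rewrite -addr_eq0 addrC r3.
  have : 12 * v = 12 * 1 by rewrite -[in RHS]r2 r3'; ring.
  have n12 : (12 : rat) != 0 by [].
  by move/(mulfI n12) => ->; rewrite /alpha; field.
have n0 : r ^+ 2 + 3 != 0.
  by apply: contra_eq_neq r2 => ->; rewrite mulr0 eq_sym pnatr_eq0.
have E : 1 - (3 - r) / (3 + r) + ((3 - r) / (3 + r)) ^+ 2 = 3 * (r ^+ 2 + 3) / (3 + r) ^+ 2.
  by field.
exists ((3 - r) / (3 + r)); rewrite /alpha E.
split; first by rewrite mulf_neq0 ?invr_eq0 ?expf_neq0 // mulf_neq0.
apply: (mulIf n0); rewrite r2; field.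
by rewrite n0 r3.
Qed.

Lemma sq_ImAlpha v : ImAlpha v -> exists w, w ^+ 2 = 27 * v * (4 - v).
Proof.
(* The witness is [3 v r] with [r = 3 (1 - u) / (1 + u)]. *)
case=> u [u0 ->]; exists (9 * (1 + u) * (1 - u) / (1 - u + u ^+ 2)).
by rewrite /alpha; field.
Qed.

(** * The Galois group in each case *)

Section Cases.
Variables (v : rat) (y1 y2 y3 th : algC) (nu0 : {rmorphism algC -> algC}).
Hypotheses (v0 : v != 0) (v4 : v != 4).
Hypothesis e1 : y1 + y2 + y3 = 3.
Hypothesis e2 : y1 * y2 + y1 * y3 + y2 * y3 = 0.
Hypothesis e3 : y1 * y2 * y3 = - ratr v.
Hypothesis pth : p3 th = 0.
Hypothesis nu0th : nu0 th = tau th.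

Let n12 : (y1 == y2) = false. Proof. by apply/negbTE/(y12 v0 v4 e1 e2 e3). Qed.
Let n23 : (y2 == y3) = false. Proof. by apply/negbTE/(y23 v0 v4 e1 e2 e3). Qed.
Let n13 : (y1 == y3) = false. Proof. by apply/negbTE/(y13 v0 v4 e1 e2 e3). Qed.
Let n21 : (y2 == y1) = false. Proof. by rewrite eq_sym. Qed.
Let n32 : (y3 == y2) = false. Proof. by rewrite eq_sym. Qed.
Let n31 : (y3 == y1) = false. Proof. by rewrite eq_sym. Qed.

Local Notation Y := (y1, y2, y3).
Local Notation disc := (disc3 Y).

Let disc0 : disc != 0.
Proof. by rewrite /disc3 /= !mulf_neq0 // subr_eq0 ?n12 ?n23 ?n13. Qed.

Lemma disc_aut (nu : {rmorphism algC -> algC}) b e :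
  (nu y1, nu y2, nu y3) = sym3 b e Y -> nu disc = if e then - disc else disc.
Proof. by rewrite -(disc_sym3 b e) => <-; rewrite /disc3 /= !rmorphM !rmorphB. Qed.

Lemma sym3_inj b e b' e' : (b < 3)%N -> (b' < 3)%N ->
  sym3 b e Y = sym3 b' e' Y -> b = b' /\ e = e'.
Proof.
move=> b3 b3' h; move/eqP: h.
case: b b3 => [|[|[|//]]] _; case: b' b3' => [|[|[|//]]] _; case: e; case: e' => //;
by rewrite /sym3 /= /rot3 /rev3 /= !xpair_eqE /= ?n12 ?n13 ?n23 ?n21 ?n31 ?n32 ?andbF.
Qed.

(** Cases with several possible classes need [H] in hand before a class is chosen. *)
Lemma gal_group_exists : exists H, gal_spec y1 y2 y3 th H /\
  forall X : {group 'S_6} -> Prop, X H -> G3bar_is (psi v) X.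
Proof.
have [l [lab [H [spec HH]]]] := gal_group v0 v4 e1 e2 e3 pth (fun H h => h).
by exists H; split=> // X XH; exists l; split=> //; exists H.
Qed.

Lemma gal_theta H : gal_spec y1 y2 y3 th H -> exists b (e : bool),
  [/\ (b < 3)%N, (nu0 y1, nu0 y2, nu0 y3) = sym3 b e Y
    & word6 1 b e \in H].
Proof.
case=> /(_ nu0) [a [b [e [a3 b3 Da Db Hw]]]] _; exists b, e; split=> //.
suff a1 : a = 1%N by move: Hw; rewrite a1.
move: Da; rewrite nu0th; case: a a3 {Hw} => [|[|[|//]]] _ //= /eqP.
  by rewrite (negPf (tau_neq pth)).
by rewrite eq_sym (negPf (tau_neq (p3_tau pth))).
Qed.

Lemma rational_root u (y : algC) : y \in [:: y1; y2; y3] -> y = ratr u -> ImBeta v.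
Proof.
move=> yY Dy; exists u; apply: (fmorph_inj (ratr : {rmorphism rat -> algC})).
rewrite rmorphM rmorphB rmorphXn rmorph_nat /= -Dy.
have -> : (ratr v : algC) = - (y1 * y2 * y3) by rewrite e3 opprK.
apply/eqP; rewrite -subr_eq0 -e1; apply/eqP.
transitivity ((y - y1) * (y - y2) * (y - y3) - (y1 * y2 + y1 * y3 + y2 * y3) * y); first by ring.
rewrite e2 mul0r subr0; move: yY; rewrite !inE => /or3P[] /eqP ->;
by rewrite subrr ?(mulr0, mul0r).
Qed.

(** Outside the image of [alpha], [disc] is irrational and some automorphism permutes the [y_i]
    oddly. Outside that of [beta], the root it fixes is irrational and is moved by another
    automorphism. *)
Lemma galW : ~ ImAlpha v -> ~ ImBeta v -> G3bar_is (psi v) isW.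
Proof.
move=> nA nB; apply: (gal_group v0 v4 e1 e2 e3 pth) => H spec.
have [b1 [e' [_ _ H1]]] := gal_theta spec.
have [toH ofH] := spec.
have sHW : H \subset W.
  apply/subsetP => w /ofH[nu [a [b [e [_ _ _ _ ->]]]]].
  exact: word6W.
have [nu nud] : exists nu : {rmorphism algC -> algC}, nu disc != disc.
  apply: moved_by_aut; apply/negP => /CratP[w Dw]; apply: nA; apply: (ImAlpha_sq (w := w)) => //.
  apply: (fmorph_inj (ratr : {rmorphism rat -> algC})).
  rewrite rmorphXn /= -Dw (disc_sq e1 e2 e3).
  by rewrite !(rmorphM, rmorphB) !rmorph_nat.
have [a [b [e [_ b3 _ Db Ht]]]] := toH nu.
have te : e = true.
  by apply: contra_neqT nud => /negbTE e0; rewrite (disc_aut Db) e0.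
rewrite te in Ht.
(* The root fixed by the transposition [sym3 b true]. *)
pose yk := nth y1 [:: y2; y3; y1] b.
have ykY : yk \in [:: y1; y2; y3].
  by rewrite {}/yk; case: b b3 {Db Ht} => [|[|[|//]]] _; rewrite !inE eqxx ?orbT.
have [nu' nuk] : exists nu : {rmorphism algC -> algC}, nu yk != yk.
  by apply: moved_by_aut; apply/negP => /CratP[u Du]; apply: nB; apply: rational_root ykY Du.
have [a' [b' [e'' [_ b3' _ Db' Hg]]]] := toH nu'.
apply: (subgroup_W sHW b3 b3' _ Hg _ H1); first exact: Ht.
move: nuk Db'; rewrite {}/yk in ykY *.
case: b b3 {Db Ht ykY} => [|[|[|//]]] _; case: b' b3' {Hg} => [|[|[|//]]] _;
case: e'' => //=; rewrite /sym3 /rot3 /rev3 /= => + [E1 E2 E3];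
by rewrite ?E1 ?E2 ?E3 eqxx.
Qed.

Lemma galA : ImAlpha v ->
  [\/ G3bar_is (psi v) isA, G3bar_is (psi v) isK | G3bar_is (psi v) isM].
Proof.
move=> /sq_ImAlpha[w w2].
have fixd (nu : {rmorphism algC -> algC}) : nu disc = disc.
  have : disc ^+ 2 == (ratr w) ^+ 2.
    rewrite (disc_sq e1 e2 e3) -rmorphXn w2.
    by rewrite !(rmorphM, rmorphB) !rmorph_nat.
  rewrite eqf_sqr => /orP[] /eqP ->; rewrite ?rmorphN fmorph_rat //.
have [H [spec G3]] := gal_group_exists.
have even (nu : {rmorphism algC -> algC}) b e : (nu y1, nu y2, nu y3) = sym3 b e Y -> e = false.
  case: e => // /disc_aut; rewrite fixd => /eqP; rewrite -subr_eq0 opprK -mulr2n.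
  by rewrite mulrn_eq0 /= (negPf disc0).
suff [HA|HK|HM] : [\/ isA H, isK H | isM H].
- by constructor 1; apply: G3.
- by constructor 2; apply: G3.
- by constructor 3; apply: G3.
apply: subgroup_A.
  move=> x Hx; have [nu [a [b [e [_ _ _ /even e0 ->]]]]] := spec.2 _ Hx.
  by exists a, b; rewrite e0 /word6 mulg1.
have [b [e [_ /even e0]]] := gal_theta spec.
by rewrite e0 /word6 mulg1 => Hb; exists b.
Qed.

(** The rational root is taken in the middle because [rev3] fixes it; fixing [y2] then means
    [b = 0]. *)
Lemma galB : y2 \in Crat -> G3bar_is (psi v) isB \/ G3bar_is (psi v) isM.
Proof.
move=> y2Q.
have [H [spec G3]] := gal_group_exists.
have fix2 (nu : {rmorphism algC -> algC}) b e : (b < 3)%N ->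
    (nu y1, nu y2, nu y3) = sym3 b e Y -> b = 0%N.
  move=> b3 /(congr1 (fun Z => Z.1.2)) /=; rewrite aut_Crat // => /eqP.
  by case: b b3 => [|[|[|//]]] _; case: e; rewrite /sym3 /rot3 /rev3 /= ?n21 ?n23.
suff [HB|HM] : isB H \/ isM H.
- by left; apply: G3.
- by right; apply: G3.
apply: subgroup_B.
  move=> x Hx; have [nu [a [b [e [_ b3 _ /(fix2 _ _ _ b3) b0 ->]]]]] := spec.2 _ Hx.
  by exists a, e; rewrite b0 /word6 mulg1.
have [b [e [b3 /(fix2 _ _ _ b3) b0]]] := gal_theta spec.
by rewrite b0 /word6 mulg1 => Hb; exists e.
Qed.

Lemma galM : y1 \in Crat -> y2 \in Crat -> y3 \in Crat -> G3bar_is (psi v) isM.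
Proof.
move=> q1 q2 q3; apply: (gal_group v0 v4 e1 e2 e3 pth) => H spec.
have fix3 (nu : {rmorphism algC -> algC}) b e : (b < 3)%N ->
    (nu y1, nu y2, nu y3) = sym3 b e Y -> b = 0%N /\ e = false.
  move=> b3; rewrite !aut_Crat // -[LHS]/(sym3 0 false Y) => /esym h.
  exact: (@sym3_inj b e 0 false b3 isT h).
apply: subgroup_M.
  move=> x Hx; have [nu [a [b [e [_ b3 _ /(fix3 _ _ _ b3)[b0 e0] ->]]]]] := spec.2 _ Hx.
  by exists a; rewrite b0 e0 /word6 !mulg1.
have [b [e [b3 /(fix3 _ _ _ b3)[b0 e0]]]] := gal_theta spec.
by rewrite b0 e0 /word6 !mulg1.
Qed.

(** Galois rotates the [y_i] exactly as it rotates [th], so [b = a] and [e = false]: every element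
    is a power of [c * j]. *)
Lemma galK (f : algC -> algC) :
  (forall (nu : {rmorphism algC -> algC}) x, nu (f x) = f (nu x)) ->
  y1 = f th -> y2 = f (tau th) -> y3 = f (tau (tau th)) -> G3bar_is (psi v) isK.
Proof.
move=> fnu D1 D2 D3; apply: (gal_group v0 v4 e1 e2 e3 pth) => H spec.
have t3 := tau3 (p3_neq0 pth) (p3_neq1 pth).
have shift (nu : {rmorphism algC -> algC}) a b e : (a < 3)%N -> (b < 3)%N ->
    nu th = iter a (@tau algC) th ->
    (nu y1, nu y2, nu y3) = sym3 b e Y -> b = a /\ e = false.
  move=> a3 b3 Da.
  have nu_tau (x : algC) : nu (tau x) = tau (nu x) by rewrite /tau rmorphB rmorph1 fmorphV.
  have -> : (nu y1, nu y2, nu y3) = sym3 a false Y.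
    rewrite {1}D1 {1}D2 {1}D3 !fnu !nu_tau Da.
    by case: a a3 {Da} => [|[|[|//]]] _; rewrite /sym3 /rot3 /= ?t3 -?D1 -?D2 -?D3.
  by move/esym/(sym3_inj b3 a3).
apply: (@subgroup_K _ 1) => //.
  move=> x Hx; have [nu [a [b [e [a3 b3 Da Db ->]]]]] := spec.2 _ Hx.
  have [-> ->] := shift _ _ _ _ a3 b3 Da Db.
  by exists a; rewrite mul1n /word6 mulg1.
have [b [e [b3 Db]]] := gal_theta spec.
have [-> ->] := shift _ 1%N _ _ isT b3 nu0th Db.
by rewrite /word6 mulg1.
Qed.

End Cases.

(** * Explicit roots for [mu] and [kappa], and the conclusion *)

Lemma e2_div (K : fieldType) (n p q r : K) : n != 0 ->
  p / n * (q / n) + p / n * (r / n) + q / n * (r / n) = (p * q + p * r + q * r) / n ^+ 2.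
Proof. by move=> n0; field. Qed.

Lemma e3_div (K : fieldType) (n p q r : K) : n != 0 ->
  p / n * (q / n) * (r / n) = p * q * r / n ^+ 3.
Proof. by move=> n0; field. Qed.

Lemma mu_roots v : ImMu v -> exists q1 q2 q3 : rat,
  [/\ q1 + q2 + q3 = 3, q1 * q2 + q1 * q3 + q2 * q3 = 0 & q1 * q2 * q3 = - v].
Proof.
case=> u [d0 []]; rewrite /alpha /r_mu.
set a := u ^+ 3 - 3 * u - 1; set d := u ^+ 3 + 3 * u ^+ 2 - 1 in d0 *.
pose n := u ^+ 2 + u + 1.
have E : 1 - a / d + (a / d) ^+ 2 = n ^+ 3 / d ^+ 2.
  transitivity ((d ^+ 2 - a * d + a ^+ 2) / d ^+ 2); first by field.
  by congr (_ / _); rewrite /a /d /n; ring.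
rewrite E => n3 ->.
have n0 : n != 0 by apply: contraNneq n3 => ->; rewrite expr0n mul0r.
have -> : (1 + a / d) ^+ 2 / (n ^+ 3 / d ^+ 2) = ((u - 1) * (2 * u + 1) * (u + 2)) ^+ 2 / n ^+ 3.
  transitivity ((a + d) ^+ 2 / n ^+ 3).
    have aux (n' d' a' : rat) : n' != 0 -> d' != 0 ->
        (1 + a' / d') ^+ 2 / (n' ^+ 3 / d' ^+ 2) = (a' + d') ^+ 2 / n' ^+ 3.
      by move=> n0' d0'; field; rewrite n0' d0'.
    exact: aux.
  by congr (_ ^+ 2 / _); rewrite /a /d; ring.
(* [e2 = 0] says that the inverses of nonzero roots sum to zero: here they are proportional to
   [u - 1], [u + 2] and [- (2 u + 1)]. The condition [e1 = 3] fixes the scale. *)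
exists ((2 * u + 1) * (u + 2) / n), ((2 * u + 1) * (u - 1) / n), (- ((u - 1) * (u + 2)) / n).
split.
- transitivity (3 * n / n); last by rewrite mulfK.
  by rewrite -!mulrDl; congr (_ / _); rewrite /n; ring.
- by rewrite e2_div //; apply/eqP; rewrite mulf_eq0; apply/orP; left; apply/eqP; ring.
by rewrite e3_div // -[RHS]mulNr; congr (_ / _); ring.
Qed.

(* Up to the denominator, [x^-1 (t - a') (t - a'')] where [a'], [a''] are the other
   conjugates of [5 - x - 2 x^2], a root of the polynomial [t^3 - 3 t^2 - 6 t - 1] squared in
   the numerator of [kappa]. *)
Definition kappa_root (K : numFieldType) (t x : K) :=
  ((3 - x ^+ 2) * t ^+ 2 + (5 - 2 * x - 2 * x ^+ 2) * t + 1 - x) / (1 + t + t ^+ 2).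

Lemma kappa_roots (K : numFieldType) (t x : K) : p3 x = 0 -> 1 + t + t ^+ 2 != 0 ->
  let y1 := kappa_root t x in let y2 := kappa_root t (tau x) in
  let y3 := kappa_root t (tau (tau x)) in
  [/\ y1 + y2 + y3 = 3, y1 * y2 + y1 * y3 + y2 * y3 = 0
    & y1 * y2 * y3 = - ((t ^+ 3 - 3 * t ^+ 2 - 6 * t - 1) ^+ 2 / (1 + t + t ^+ 2) ^+ 3)].
Proof.
move=> px n0 y1 y2 y3; have [T1 T2] := tau_poly px.
have x1 : (x ^+ 2 - 2) ^+ 2 = 4 - x - x ^+ 2.
  apply/eqP; rewrite -subr_eq0; apply/eqP.
  by transitivity (x * p3 x); [rewrite /p3; ring | rewrite px mulr0].
have x2 : (2 - x - x ^+ 2) ^+ 2 = 2 + x.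
  apply/eqP; rewrite -subr_eq0; apply/eqP.
  by transitivity ((x + 2) * p3 x); [rewrite /p3; ring | rewrite px mulr0].
pose N1 := (3 - x ^+ 2) * t ^+ 2 + (5 - 2 * x - 2 * x ^+ 2) * t + 1 - x.
pose N2 := (x ^+ 2 + x - 1) * t ^+ 2 + (1 + 2 * x) * t + 3 - x ^+ 2.
pose N3 := (1 - x) * t ^+ 2 + (2 * x ^+ 2 - 3) * t + x ^+ 2 + x - 1.
set n := 1 + t + t ^+ 2 in n0 *.
have D1 : y1 = N1 / n by [].
have D2 : y2 = N2 / n.
  by rewrite /y2 /kappa_root T1 x1 /N2; congr (_ / _); ring.
have D3 : y3 = N3 / n.
  by rewrite /y3 /kappa_root T2 x2 /N3; congr (_ / _); ring.
have E2 : N1 * N2 + N1 * N3 + N2 * N3 = 0.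
  transitivity (- (x + 1) * n ^+ 2 * p3 x); last by rewrite px mulr0.
  by rewrite /N1 /N2 /N3 /n /p3; ring.
have E3 : N1 * N2 * N3 = - (t ^+ 3 - 3 * t ^+ 2 - 6 * t - 1) ^+ 2.
  apply/eqP; rewrite -subr_eq0 opprK; apply/eqP.
  (* The long factor is the quotient by [p3 x] of [N1 * N2 * N3] plus the squared numerator of
     [kappa]. *)
  transitivity (((- 2) * x ^+ 0 * t ^+ 0 + (- 13) * x ^+ 0 * t ^+ 1 + (- 16) * x ^+ 0 * t ^+ 2 + (13) * x ^+ 0 * t ^+ 3 + (19) * x ^+ 0 * t ^+ 4 + (1) * x ^+ 0 * t ^+ 5 + (- 2) * x ^+ 0 * t ^+ 6 + (- 9) * x ^+ 1 * t ^+ 1 + (- 36) * x ^+ 1 * t ^+ 2 + (- 27) * x ^+ 1 * t ^+ 3 + (9) * x ^+ 1 * t ^+ 4 + (9) * x ^+ 1 * t ^+ 5 + (1) * x ^+ 2 * t ^+ 0 + (6) * x ^+ 2 * t ^+ 1 + (- 20) * x ^+ 2 * t ^+ 3 + (- 15) * x ^+ 2 * t ^+ 4 + (1) * x ^+ 2 * t ^+ 6 + (2) * x ^+ 3 * t ^+ 1 + (5) * x ^+ 3 * t ^+ 2 + (- 5) * x ^+ 3 * t ^+ 4 + (- 2) * x ^+ 3 * t ^+ 5) * p3 x); last by rewrite px mulr0.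
  by rewrite /N1 /N2 /N3 /p3; ring.
rewrite D1 D2 D3; split.
- transitivity (3 * n / n); last by rewrite mulfK.
  by rewrite -!mulrDl; congr (_ / _); rewrite /N1 /N2 /N3 /n; ring.
- transitivity ((N1 * N2 + N1 * N3 + N2 * N3) / n ^+ 2); last by rewrite E2 mul0r.
  exact: e2_div.
rewrite -mulNr -E3.
exact: e3_div.
Qed.

Theorem theorem1p2 (phi : {poly rat} * {poly rat}) :
  rf_valid phi -> rf_deg phi = 2%N ->
  (exists P, periodic (dyn phi) 2 P /\ rf_crit (rf_map phi) P) ->
  aut_nontrivial phi ->
  (exists v : rat, [/\ v != 0, v != 4 & lin_conj_Q phi (psi v)]) /\
  (forall v : rat, v != 0 -> v != 4 -> lin_conj_Q phi (psi v) -> v != 1 ->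
     [/\ (~ ImAlpha v -> ~ ImBeta v -> G3_is phi isW),
         (ImAlpha v -> [\/ G3_is phi isA, G3_is phi isK | G3_is phi isM]),
         (ImBeta v -> G3_is phi isB \/ G3_is phi isM),
         (ImMu v -> G3_is phi isM)
       & (ImKappa v -> G3_is phi isK)]).
Proof.
move=> vf df [P [perP crit]] [sigma [vs [ds [comm moved]]]]; split.
  have vf' : rf_valid (rf_map phi) by rewrite rf_map_valid.
  have df' : rf_deg (rf_map phi) = 2%N by rewrite rf_map_deg.
  have [d1 d2] := crit_two_cycle_div_free vf' df' perP crit vs ds comm moved.
  (* The divergence has rational coefficients, so its vanishing descends to Q. *)
  apply: div_free_conj_psi => //; apply: (fmorph_inj (ratr : {rmorphism rat -> algC})).
    by move: d1; rewrite !coef_map rmorphD rmorphM rmorph_nat rmorph0.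
  by move: d2; rewrite !coef_map rmorphD rmorphM rmorph_nat rmorph0.
move=> v v0 v4 conj _.
have lift X : G3bar_is (psi v) X -> G3_is phi X.
  by move=> h; apply: G3bar_G3; apply: G3bar_lin_conj conj h.
have [th [nu0 [pth nuth]]] := exists_theta.
have [y1 [y2 [y3 [e1 e2 e3]]]] := cubic_roots v.
split.
- by move=> nA nB; apply/lift/(galW v0 v4 e1 e2 e3 pth nuth).
- by case/(galA v0 v4 e1 e2 e3 pth nuth) => /lift; [constructor 1|constructor 2|constructor 3].
- case=> u Du.
  suff [z1 [z3 [f1 f2 f3]]] : exists z1 z3 : algC, [/\ z1 + ratr u + z3 = 3,
      z1 * ratr u + z1 * z3 + ratr u * z3 = 0 & z1 * ratr u * z3 = - ratr v].
    have uQ : (ratr u : algC) \in Crat by apply: Crat_rat.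
    by case: (galB v0 v4 f1 f2 f3 pth nuth uQ) => /lift; [left|right].
  have : (ratr u - y1) * (ratr u - y2) * (ratr u - y3) = 0 :> algC.
    transitivity ((ratr u) ^+ 3 - (y1 + y2 + y3) * (ratr u) ^+ 2 +
      (y1 * y2 + y1 * y3 + y2 * y3) * ratr u - y1 * y2 * y3); first by ring.
    rewrite e1 e2 e3 Du rmorphM rmorphB rmorphXn rmorph_nat /=; ring.
  (* Whichever [y_i] is the rational root, the triple is reordered to place it in the middle. *)
  move/eqP; rewrite !mulf_eq0 !subr_eq0 -orbA => /or3P[] /eqP ->.
  + by exists y2, y3; rewrite -e1 -e2 -e3; split; ring.
  + by exists y1, y3.
  + by exists y1, y2; rewrite -e1 -e2 -e3; split; ring.
- case/mu_roots=> q1 [q2 [q3 [f1 f2 f3]]]; apply: lift.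
  have R1 : ratr q1 + ratr q2 + ratr q3 = 3 :> algC by rewrite -!rmorphD f1 rmorph_nat.
  have R2 : ratr q1 * ratr q2 + ratr q1 * ratr q3 + ratr q2 * ratr q3 = 0 :> algC.
    by rewrite -!rmorphM -!rmorphD f2 rmorph0.
  have R3 : ratr q1 * ratr q2 * ratr q3 = - ratr v :> algC by rewrite -!rmorphM f3 rmorphN.
  by apply: (galM v0 v4 R1 R2 R3 pth nuth); apply: Crat_rat.
case=> u [n0 Dv]; apply: lift.
have n0' : 1 + ratr u + (ratr u) ^+ 2 != 0 :> algC.
  have -> : 1 + ratr u + (ratr u) ^+ 2 = ratr (1 + u + u ^+ 2) :> algC.
    by rewrite !rmorphD rmorph1 rmorphXn.
  by rewrite fmorph_eq0.
have [f1 f2 f3] := kappa_roots pth n0'.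
apply: (galK v0 v4 f1 f2 _ pth nuth (f := kappa_root (ratr u))) => //.
  by rewrite f3 Dv fmorph_div !(rmorphXn, rmorphD, rmorphN, rmorphM, rmorph1).
move=> nu x; have := fmorph_rat nu u; move: (ratr u) => r Dr.
by rewrite /kappa_root fmorph_div !(rmorphXn, rmorphD, rmorphN, rmorphM, rmorph1) Dr.
Qed.
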